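(* Let $\gamma>0$, let $V\in\mathbb{V}_\gamma$, and let $-\pi\le a<b\le \pi$, $w=\mathbb{R}\times\,]a,b[\,\subset X$. Suppose that all the eigenvalues of $P_V$ have multiplicity $2$. Then the concentration inequality for eigenfunctions holds on $w$, i.e. $$\exists C>0,\ \forall E\ge 0,\ \forall \phi\in\ker(P_V-E),\qquad \|\phi\|_{L^2(X)}\le C\,\|\phi\|_{L^2(w)}.$$
   Context: $X=\mathbb{R}\times\mathbb{S}^1$ is the infinite cylinder with fundamental domain $\mathbb{R}\times[-\pi,\pi]$ (coordinates $(x,y)$) and Lebesgue measure $dx\,dy$. $L^2_0(X)$ is the closed subspace of (complex-valued) $u\in L^2(X)$ with $\int_{\mathbb{S}^1}u(x,y)\,dy=0$ for a.e. $x$ (the orthogonal complement of the functions depending only on $x$). For $\gamma>0$, $\mathbb{V}_\gamma=\{V=|x|^{2\gamma}\widetilde W:\ \widetilde W:\mathbb{R}\to\mathbb{R}\text{ continuous and bounded},\ \widetilde W\ge 1\}$. For $V\in\mathbb{V}_\gamma$, the generalized Baouendi-Grushin operator is $P_V=-\partial_x^2-V(x)\partial_y^2$ acting in $L^2_0(X)$. Defined on the smooth compactly supported functions in $L^2_0(X)$ it is essentially self-adjoint, and $P_V$ also denotes its unique self-adjoint extension; it has compact resolvent, so its spectrum consists of eigenvalues of finite multiplicity tending to $+\infty$. The multiplicity of an eigenvalue $E$ is the (complex) dimension of $\ker(P_V-E)$. *)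

(* Defs.v *)
From HB Require Import structures.
From mathcomp Require Import all_boot all_order all_algebra.
From mathcomp Require Import all_classical all_reals all_analysis.
From mathcomp Require Import complex.

Set Implicit Arguments.
Unset Strict Implicit.
Unset Printing Implicit Defensive.
Import Order.TTheory GRing.Theory Num.Theory.
Import numFieldNormedType.Exports.

Local Open Scope classical_set_scope.
Local Open Scope ring_scope.
Local Open Scope complex_scope.

(* Functions on the cylinder X = R x (R / 2 pi Z) are functions of (x, y) in
   R x R that are 2 pi-periodic in y; integrals over X are integrals over the
   fundamental domain [cylinder].  Elements of L^2 are represented by functions,
   and equality in L^2 is equality almost everywhere [eqX]. *)

Section Cylinder.
Variable R : realType.

Local Notation plane := (measurableTypeR R * measurableTypeR R)%type.

Definition area : {measure set plane -> \bar R} :=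
  (@lebesgue_measure R \x @lebesgue_measure R)%E.

Definition strip (I : set R) : set (R * R) := [set z | I z.2].

Definition cylinder : set (R * R) := strip `[- pi, pi].

Definition periodic (u : R * R -> R[i]) : Prop :=
  forall x y : R, u (x, y + 2 * pi) = u (x, y).

Definition eqX (u v : R * R -> R[i]) : Prop :=
  {ae area, forall z, cylinder z -> u z = v z}.

Definition cintegral d (T : measurableType d)
    (mu : {measure set T -> \bar R}) (A : set T) (f : T -> R[i]) : R[i] :=
  Rintegral mu A (fun t => complex.Re (f t)) +i*
  Rintegral mu A (fun t => complex.Im (f t)).

Definition sqmod (z : R[i]) : R := complex.Re z ^+ 2 + complex.Im z ^+ 2.

Definition L2X (u : R * R -> R[i]) : Prop :=
  [/\ periodic u,
      measurable_fun [set: plane] (fun z : plane => complex.Re (u z)),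
      measurable_fun [set: plane] (fun z : plane => complex.Im (u z))
    & (\int[area]_(z in cylinder) (sqmod (u z))%:E < +oo)%E].

Definition L2norm (A : set (R * R)) (u : R * R -> R[i]) : R :=
  Num.sqrt (Rintegral area A (fun z => sqmod (u z))).

Definition L2dot (u v : R * R -> R[i]) : R[i] :=
  cintegral area cylinder (fun z => u z * (v z)^*).

Definition L20X (u : R * R -> R[i]) : Prop :=
  L2X u /\
  {ae @lebesgue_measure R, forall x : R,
    cintegral (@lebesgue_measure R) `[- pi, pi] (fun y => u (x, y)) = 0}.

(* The boolean selects the variable: false for x, true for y. *)
Definition slice (b : bool) (f : R * R -> R) (z : R * R) : R -> R :=
  if b then fun t => f (z.1, t) else fun t => f (t, z.2).

Definition coordinate (b : bool) (z : R * R) : R := if b then z.2 else z.1.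

Definition partial (b : bool) (f : R * R -> R) (z : R * R) : R :=
  derive1 (slice b f z) (coordinate b z).

(* C^oo: the iterated partial derivatives of all orders, taken in any order,
   exist and are continuous. *)
Definition smooth (f : R * R -> R) : Prop :=
  forall s : seq bool, let g := foldr partial f s in
    continuous g /\
    forall (b : bool) (z : R * R), derivable (slice b g z) (coordinate b z) 1.

Definition csmooth (u : R * R -> R[i]) : Prop :=
  smooth (fun z => complex.Re (u z)) /\ smooth (fun z => complex.Im (u z)).

Definition cpartial (b : bool) (u : R * R -> R[i]) (z : R * R) : R[i] :=
  partial b (fun z => complex.Re (u z)) z +i*
  partial b (fun z => complex.Im (u z)) z.

(* As the circle is compact, a function on X has compact support exactly when
   it vanishes for large |x|. *)
Definition test_function (u : R * R -> R[i]) : Prop :=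
  [/\ csmooth u, L20X u
    & exists M : R, forall x y : R, M < `|x| -> u (x, y) = 0].

Definition potential_class (gamma : R) (V : R -> R) : Prop :=
  exists W : R -> R,
    [/\ continuous W,
        exists M : R, forall x, `|W x| <= M,
        forall x, 1 <= W x
      & forall x, V x = (`|x| `^ (2 * gamma)) * W x].

Definition grushin (V : R -> R) (u : R * R -> R[i]) (z : R * R) : R[i] :=
  - cpartial false (cpartial false u) z
  - (V z.1)%:C * cpartial true (cpartial true u) z.

(* An unbounded operator on L^2_0(X) is given by its graph, a set of pairs of
   representatives saturated for [eqX]. *)
Definition operator := set ((R * R -> R[i]) * (R * R -> R[i])).

Definition adjoint (P : operator) : operator :=
  [set uv | [/\ L20X uv.1, L20X uv.2
    & forall psi g, P (psi, g) -> L2dot uv.1 g = L2dot uv.2 psi]].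

(* P = P^* forces the graph P to be linear, closed, and saturated for [eqX];
   it is single-valued modulo [eqX] because the test functions, which are dense
   in L^2_0(X), belong to the domain. *)
Definition self_adjoint_extension (V : R -> R) (P : operator) : Prop :=
  P = adjoint P /\ forall u, test_function u -> P (u, grushin V u).

(* P is P_V, the unique self-adjoint extension of the operator [grushin V]
   defined on the test functions. *)
Definition is_grushin_operator (V : R -> R) (P : operator) : Prop :=
  unique (self_adjoint_extension V) P.

Definition op_eigenspace (P : operator) (E : R) : set (R * R -> R[i]) :=
  [set u | P (u, fun z => E%:C * u z)].

(* Eigenvalues of a self-adjoint operator are real. *)
Definition op_eigenvalue (P : operator) (E : R) : Prop :=
  exists2 u, op_eigenspace P E u & ~ eqX u (fun=> 0).

(* The complex dimension, modulo [eqX], of a subspace S of L^2(X). *)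
Definition has_dimension (S : set (R * R -> R[i])) (n : nat) : Prop :=
  exists e : 'I_n -> R * R -> R[i],
    [/\ forall i, S (e i),
        forall c : 'I_n -> R[i],
          eqX (fun z => \sum_(i < n) c i * e i z) (fun=> 0) ->
          forall i, c i = 0
      & forall u, S u -> exists c : 'I_n -> R[i],
          eqX u (fun z => \sum_(i < n) c i * e i z)].

End Cylinder.

Arguments area {R}.
Arguments cylinder {R}.

(* Main.v *)
Require Import Defs.
From HB Require Import structures.
From mathcomp Require Import all_boot all_order all_algebra.
From mathcomp Require Import all_classical all_reals all_analysis.
From mathcomp Require Import measurable_realfun.
From mathcomp Require Import complex.
From mathcomp Require Import ring lra.
Import Order.TTheory GRing.Theory Num.Theory.
Import numFieldNormedType.Exports.
Local Open Scope classical_set_scope.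
Local Open Scope ring_scope.
Set Implicit Arguments.
Unset Strict Implicit.
Unset Printing Implicit Defensive.

(** Two symmetries of the operator carry the proof.  Its action on test functions
    commutes with the translations in [y] and with complex conjugation [U]; the
    conjugated operator [U^-1 P U] is then again a self-adjoint extension, and
    uniqueness makes it equal to [P] ([symmetry_of_operator]).  So the eigenspaces
    are stable under translations and conjugation.

    By conjugation the real and imaginary parts of an eigenfunction are
    eigenfunctions ([op_eigenspace_parts]).  By translation, so is every average of
    a real eigenfunction [f] over its translates with the weight [cos (n s + phi)]
    ([ip_mode], [real_eigen_mode]).  If [A x] and [B x] are the [n]-th cosine and
    sine coefficients of [f (x, _)], this average is [A cos n y + B sin n y] for
    [phi = 0] and [B cos n y - A sin n y] for [phi = - pi / 2].  Some [n >= 1] gives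
    a nonzero average when [f] is nonzero with zero mean on the circles
    ([real_L20_complete]), and then the two averages are linearly independent, since
    one is a quarter-period translate of the other ([modes_independent]).

    When the eigenspace has dimension 2 it is spanned by these two averages, hence
    there is one frequency [n >= 1] such that every eigenfunction is of the form
    [c x cos n y + d x sin n y] ([eigenspace_single_frequency]).  For such a wave,
    the integral of the square over the circle is [pi (c^2 + d^2)], and over an arc
    of length [theta] it is at least
    [(theta - |sin (n theta)| / n) (c^2 + d^2) / 2].  As
    [|sin (n theta)| <= n |sin theta|], the factor is at least
    [theta - |sin theta| > 0], which depends neither on [n] nor on the eigenvalue
    ([integral_trig_sqr_arc_ge]); integrating in [x] gives the inequality with
    [C^2 = 2 pi / (theta - |sin theta|)] and [theta = b - a] ([wave_concentration]).

    The nonzero average comes from the uniqueness of Fourier coefficients for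
    integrable functions on the circle ([fourier_null_ae0]): orthogonality to all
    harmonics passes to products with polynomials in [cos (y - c)], hence to
    products with indicators of arcs, and Lebesgue differentiation concludes. *)

(** * Real-valued integrable functions *)

Section RealIntegrable.
Context d (T : measurableType d) (R : realType).
Variables (mu : {measure set T -> \bar R}) (D : set T).
Hypothesis mD : measurable D.
Implicit Types (f g : T -> R) (k : R).

Lemma integrable_scale f k : mu.-integrable D (EFin \o f) ->
  mu.-integrable D (EFin \o (fun x => k * f x)).
Proof. by move=> fi; exact: (integrableZl mD k fi). Qed.

Lemma integrable_add f g : mu.-integrable D (EFin \o f) ->
  mu.-integrable D (EFin \o g) -> mu.-integrable D (EFin \o (fun x => f x + g x)).
Proof. by move=> fi gi; exact: (integrableD mD fi gi). Qed.

Lemma integrable_mul_le1 f g : measurable_fun D g ->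
  (forall x, `|g x| <= 1) -> mu.-integrable D (EFin \o f) ->
  mu.-integrable D (EFin \o (fun x => f x * g x)).
Proof.
move=> mg g1 fi; have fi0 := fi; apply: (le_integrable mD _ _ fi0).
  apply/measurable_EFinP; apply: measurable_funM => //.
  by apply/measurable_EFinP; exact: measurable_int fi.
by move=> y _ /=; rewrite lee_fin normrM -[leRHS]mulr1 ler_wpM2l.
Qed.

Lemma integral_indicM f :
  (\int[mu]_x (f x * \1_D x)%:E = \int[mu]_(x in D) (f x)%:E)%E.
Proof.
rewrite [RHS]integral_mkcond; apply: eq_integral => x _.
by rewrite patchE indicE; case: ifP; rewrite ?mulr1 ?mulr0.
Qed.
End RealIntegrable.

(** * Integration over the circle *)

Section Circle.
Variable R : realType.
Local Notation lam := (@lebesgue_measure R).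
Local Notation circle := (`[- pi, pi]%classic : set (measurableTypeR R)).

Lemma measurable_circle : measurable circle. Proof. exact: measurable_itv. Qed.

Lemma lebesgue_measure_circle : lam circle = (2 * pi)%:E.
Proof.
have pi0 := @pi_gt0 R; rewrite lebesgue_measure_itv/= lte_fin ifT; last lra.
by rewrite -EFinD; congr EFin; lra.
Qed.

Lemma integrable_circle_cst (k : R) :
  lam.-integrable circle (EFin \o (fun _ : R => k)).
Proof.
apply: measurable_bounded_integrable => //.
  by rewrite -[ltLHS]/(lam circle) lebesgue_measure_circle ltry.
exact: bounded_cst.
Qed.
End Circle.

Section PeriodicIntegrals.
Variable R : realType.
Local Notation lam := (@lebesgue_measure R).

Lemma measurable_shift (s : R) :
  measurable_fun [set: measurableTypeR R]
    (fun y => y + s : measurableTypeR R).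
Proof.
rewrite -[measurable_fun _ _]/(measurable_fun [set: measurableTypeR R] (fun y =>
  (y + s : R))).
by apply: measurable_funD => //; exact: measurable_cst.
Qed.

Lemma lebesgue_measure_shift (s : R) (A : set (measurableTypeR R)) :
  measurable A ->
  lam A = pushforward lam (fun y : measurableTypeR R => y + s) A.
Proof.
have ms := measurable_shift s.
pose Ph : {measure set (measurableTypeR R) -> \bar R} :=
  measure_function_pushforward__canonical__measure_function_Measure lam ms.
move=> mA; rewrite (@lebesgue_measure_unique _ Ph) // => X [[p q] /= _ <-].
rewrite /Ph/= /pushforward.
rewrite [X in _ = lam X](_ : _ = `]p - s, q - s]%classic); last first.
  by apply/seteqP; split => y /=; rewrite !in_itv/= ltrBlDr lerBrDr.
by rewrite !lebesgue_measure_itv/= !lte_fin ltrD2r -!EFinD; case: ifP => // _;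
  congr EFin; lra.
Qed.

Local Open Scope ereal_scope.
Lemma ge0_integral_shift (s : R) (f : R -> \bar R) (D : set R) :
  measurable D -> measurable_fun [set: measurableTypeR R] f -> (forall y, 0 <= f y) ->
  \int[lam]_(y in (fun y => y + s)%R @^-1` D) f (y + s)%R =
  \int[lam]_(y in D) f y.
Proof.
move=> mD mf f0; have ms := measurable_shift s.
have := @ge0_integral_pushforward _ _ _ _ R _ ms lam D f mD
  (measurable_funS measurableT (@subsetT _ D) mf) (fun y _ => f0 y).
move=> <-; apply: eq_measure_integral => A mA _; exact/esym/lebesgue_measure_shift.
Qed.

(** The shifted window is [[- pi + s, pi + s]]; its part beyond [pi] is moved back
    by one period and fills the gap left at the other end. *)
Lemma ge0_integral_periodic_shift_pos (s : R) (f : R -> \bar R) :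
  (0 <= s <= 2 * pi)%R -> measurable_fun [set: measurableTypeR R] f ->
  (forall y, 0 <= f y) -> (forall y, f (y + 2 * pi)%R = f y) ->
  \int[lam]_(y in `[(- pi)%R, pi]) f (y + s)%R = \int[lam]_(y in `[(- pi)%R, pi]) f y.
Proof.
move=> /andP[s0 s2] mf f0 fper.
have mfs (D : set R) g : measurable_fun [set: measurableTypeR R] g ->
  measurable_fun D (g : R -> \bar R).
  by move=> mg; exact: measurable_funS mg.
have mfsh : measurable_fun [set: measurableTypeR R] (fun y => f (y + s)%R).
  exact: (measurableT_comp mf (measurable_shift s)).
rewrite -2?integral_itv_bndo_bndc; [|exact: mfs..].
have split_at (p c q : R) : (p <= c)%R -> (c <= q)%R ->
    \int[lam]_(y in `[p, q[) f y =
    \int[lam]_(y in `[p, c[) f y + \int[lam]_(y in `[c, q[) f y.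
  move=> pc cq; rewrite (@itv_bndbnd_setU _ _ _ (BLeft c)) ?bnd_simp//.
  rewrite ge0_integral_setU//=; first exact: mfs.
  apply/disj_set2P; apply/seteqP; split => // x [] /=; rewrite !in_itv/=.
  by move=> /andP[_ xc] /andP[/le_lt_trans/(_ xc)]; rewrite ltxx.
have shift_itv (c p q : R) : \int[lam]_(y in `[p, q[) f (y + c)%R =
    \int[lam]_(y in `[(p + c)%R, (q + c)%R[) f y.
  rewrite -(@ge0_integral_shift c f)//.
  have <- // : (fun y => y + c)%R @^-1` `[(p + c)%R, (q + c)%R[ = `[p, q[%classic.
  by apply/seteqP; split => y /=; rewrite !in_itv/= lerD2r ltrD2r.
rewrite shift_itv (split_at _ pi) ?lerDl//; last by rewrite -lerBrDr; lra.
rewrite [RHS](split_at _ (- pi + s)%R) ?lerDl//; last by rewrite -lerBrDl; lra.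
rewrite addeC; congr (_ + _).
have := shift_itv (2 * pi)%R (- pi)%R (- pi + s)%R.
have -> : (- pi + s + 2 * pi = pi + s :> R)%R by lra.
have -> : (- pi + 2 * pi = pi :> R)%R by lra.
by move=> <-; apply: eq_integral => y _; exact: fper.
Qed.

Lemma ge0_integral_periodic_shift (s : R) (f : R -> \bar R) :
  (`|s| <= 2 * pi)%R -> measurable_fun [set: measurableTypeR R] f ->
  (forall y, 0 <= f y) -> (forall y, f (y + 2 * pi)%R = f y) ->
  \int[lam]_(y in `[(- pi)%R, pi]) f (y + s)%R = \int[lam]_(y in `[(- pi)%R, pi]) f y.
Proof.
move=> s2 mf f0 fper; have [s0|s0] := leP 0%R s.
  by apply: ge0_integral_periodic_shift_pos => //; rewrite s0 -(ger0_norm s0).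
rewrite -(@ge0_integral_periodic_shift_pos (- s) (fun y => f (y + s)%R)).
- by apply: eq_integral => y _; rewrite subrK.
- by rewrite oppr_ge0 ltW// -(ltr0_norm s0).
- exact: (measurableT_comp mf (measurable_shift s)).
- by [].
- by move=> y; rewrite addrAC fper.
Qed.
End PeriodicIntegrals.

(** * Trigonometric waves on an arc *)

Section Trigonometry.
Variable R : realType.
Local Notation lam := (@lebesgue_measure R).
Implicit Types (x k c d p q : R) (n : nat).

(** This removes the frequency from the concentration constant. *)
Lemma norm_sin_natmul_le n x : `|sin (n%:R * x)| <= n%:R * `|sin x|.
Proof.
elim: n => [|n IHn]; first by rewrite !mul0r sin0 normr0.
rewrite -natr1 mulrDl mul1r sinD (le_trans (ler_normD _ _))// mulrDl mul1r.
rewrite !normrM lerD//.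
  by rewrite -[leRHS]mulr1 (le_trans (ler_wpM2r _ IHn))// ler_wpM2l ?cos_max// mulr_ge0.
by rewrite -[leRHS]mul1r ler_wpM2r// cos_max.
Qed.

(** This makes the concentration constant finite. *)
Lemma norm_sin_lt x : 0 < x -> `|sin x| < x.
Proof.
move=> x0; have [x1|x1] := ltP 1 x; first exact: le_lt_trans (sin_max x) x1.
have [|c c0x] := @MVT R (@sin R) (@cos R) 0 x x0 (fun y _ => is_derive_sin y).
  by apply: continuous_subspaceT; exact: continuous_sin.
rewrite sin0 !subr0 => ->; move: c0x; rewrite in_itv/= => /andP[c0 cx].
have pi2 := @pi_ge2 R.
rewrite normrM (gtr0_norm x0) gtr_pMl// ltr_norml; apply/andP; split.
  apply: (@lt_le_trans _ _ 0); first by rewrite ltrN10.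
  by apply: cos_ge0_pihalf; lra.
by rewrite -[ltRHS](@cos0 R) ltr_cos ?in_itv/=; lra.
Qed.

Lemma sin_natmul_pi n : sin (n%:R * pi) = 0 :> R.
Proof.
elim: n => [|n IHn]; first by rewrite mul0r sin0.
by rewrite -natr1 mulrDl mul1r sinDpi IHn oppr0.
Qed.

Lemma is_derive_mull k x : is_derive x 1 (fun y => k * y) k.
Proof.
apply: (is_derive_eq (is_deriveZ k (is_derive_id x (1 : R)))); exact: mulr1.
Qed.

Lemma is_derive_sin_mul k x :
  is_derive x 1 (fun y => sin (k * y)) (k * cos (k * x)).
Proof.
rewrite mulrC; exact: is_derive1_comp (is_derive_sin _) (is_derive_mull k x).
Qed.

Lemma is_derive_cos_mul k x :
  is_derive x 1 (fun y => cos (k * y)) (- sin (k * x) * k).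
Proof. exact: is_derive1_comp (is_derive_cos _) (is_derive_mull k x). Qed.

(** A primitive of [(c * cos (k * y) + d * sin (k * y)) ^+ 2], with
    [sin (2 k y)] and [1 - cos (2 k y)] written as products so that no
    double-angle formula enters the differentiation. *)
Definition trig_primitive c d k y : R :=
  (c ^+ 2 + d ^+ 2) / 2 * y +
  (2 * k)^-1 * ((c ^+ 2 - d ^+ 2) * (sin (k * y) * cos (k * y)) +
   2 * c * d * (sin (k * y) * sin (k * y))).

Lemma is_derive_trig_primitive c d k x : k != 0 ->
  is_derive x 1 (trig_primitive c d k) ((c * cos (k * x) + d * sin (k * x)) ^+ 2).
Proof.
move=> k0; have := is_derive_sin_mul k x; have := is_derive_cos_mul k x => dC dS.
have dSC := is_deriveM dS dC; have dSS := is_deriveM dS dS.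
have dL := is_derive_mull ((c ^+ 2 + d ^+ 2) / 2) x.
have := is_deriveD dL (is_deriveZ (2 * k)^-1
  (is_deriveD (is_deriveZ (c ^+ 2 - d ^+ 2) dSC) (is_deriveZ (2 * c * d) dSS))).
move=> dF; apply: (is_derive_eq dF); rewrite /GRing.scale/=.
have : (cos (k * x)) ^+ 2 = 1 - sin (k * x) ^+ 2 by exact: cos2sin2.
move: (cos _) (sin _) => C S h.
have -> : (c ^+ 2 + d ^+ 2) / 2 = (c ^+ 2 + d ^+ 2) / 2 * (C ^+ 2 + S ^+ 2).
  by rewrite h subrK mulr1.
by field.
Qed.

Lemma integral_trig_sqr c d k p q : k != 0 -> p < q ->
  (\int[lam]_(y in `[p, q]) ((c * cos (k * y) + d * sin (k * y)) ^+ 2)%:E =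
  (trig_primitive c d k q - trig_primitive c d k p)%:E)%E.
Proof.
move=> k0 pq; have dF := fun x => is_derive_trig_primitive c d x k0.
rewrite EFinB; apply: continuous_FTC2 => //.
- apply: derivable_within_continuous => x _; exact: ex_derive.
- have cF x : {for x, continuous (trig_primitive c d k)}.
    by apply/differentiable_continuous/derivable1_diffP; case: (dF x).
  split; first by move=> x _; case: (dF x).
    exact/cvg_at_right_filter/cF.
  exact/cvg_at_left_filter/cF.
- by move=> x _; rewrite derive1E; case: (dF x).
Qed.

Lemma integral_trig_sqr_circle c d n : (0 < n)%N ->
  (\int[lam]_(y in `[(- pi)%R, pi]) ((c * cos (n%:R * y) + d * sin (n%:R * y)) ^+ 2)%:E =
  (pi * (c ^+ 2 + d ^+ 2))%:E)%E.
Proof.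
move=> n0; rewrite integral_trig_sqr ?pnatr_eq0 ?lt0n_neq0//; last first.
  by have := @pi_gt0 R; lra.
rewrite /trig_primitive (mulrN n%:R) sinN cosN sin_natmul_pi; congr EFin; field.
by rewrite pnatr_eq0 lt0n_neq0.
Qed.

(** The integral is [theta (c^2 + d^2) / 2 + sin (n theta) B / (2 n)] with
    [theta = q - p], where [B] is the scalar product of [(c^2 - d^2, 2 c d)] with a
    unit vector.  That vector has norm [c^2 + d^2], so the second term is at least
    [- |sin theta| (c^2 + d^2) / 2]. *)
Lemma integral_trig_sqr_arc_ge c d n p q : (0 < n)%N -> p < q ->
  (((q - p - `|sin (q - p)|) * ((c ^+ 2 + d ^+ 2) / 2))%:E <=
  \int[lam]_(y in `]p, q[) ((c * cos (n%:R * y) + d * sin (n%:R * y)) ^+ 2)%:E)%E.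
Proof.
move=> n0 pq; have n0R : n%:R != 0 :> R by rewrite pnatr_eq0 lt0n_neq0.
have n0R' : 0 < n%:R :> R by rewrite ltr0n.
have <- := @integral_itv_bndoo R p q _ true false; last first.
  apply/measurable_EFinP; apply: measurable_funX.
  apply: measurable_funTS; apply: continuous_measurable_fun => x.
  have h := is_deriveD (is_deriveZ c (is_derive_cos_mul n%:R x))
    (is_deriveZ d (is_derive_sin_mul n%:R x)).
  by apply/differentiable_continuous/derivable1_diffP; case: h.
rewrite integral_trig_sqr// lee_fin /trig_primitive.
(* Differences of sin 2a and of cos 2a, as products. *)
have [E1 E2] : sin (n%:R * q) * cos (n%:R * q) - sin (n%:R * p) * cos (n%:R * p) =
    sin (n%:R * (q - p)) * cos (n%:R * (q + p)) /\
    sin (n%:R * q) * sin (n%:R * q) - sin (n%:R * p) * sin (n%:R * p) =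
    sin (n%:R * (q - p)) * sin (n%:R * (q + p)).
  rewrite !mulrDr mulrN sinB cosD sinD.
  have := cos2sin2 (n%:R * q); have := cos2sin2 (n%:R * p).
  move: (cos (n%:R * q)) (sin (n%:R * q)) (cos (n%:R * p)) (sin (n%:R * p)).
  move=> C' S' C S h h'.
  split.
    transitivity (S' * C' * (C ^+ 2 + S ^+ 2) - S * C * (C' ^+ 2 + S' ^+ 2));
      last by ring.
    by rewrite h h' !subrK !mulr1.
  transitivity (S' ^+ 2 * (C ^+ 2 + S ^+ 2) - S ^+ 2 * (C' ^+ 2 + S' ^+ 2)); last by ring.
  by rewrite h h' !subrK !mulr1 !expr2.
set th := q - p; set psi := n%:R * (q + p).
have cs := cos2sin2 psi.
set A := c ^+ 2 + d ^+ 2.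
pose B := (c ^+ 2 - d ^+ 2) * cos psi + 2 * c * d * sin psi.
have A0 : 0 <= A by rewrite addr_ge0 ?sqr_ge0.
have BA : `|B| <= A.
  rewrite -ler_sqr ?nnegrE// real_normK ?num_real// -subr_ge0.
  rewrite (_ : _ - _ = ((c ^+ 2 - d ^+ 2) * sin psi - 2 * c * d * cos psi) ^+ 2)
    ?sqr_ge0//.
  rewrite /A /B; move: cs; move: (cos _) (sin _) => C S h.
  transitivity ((c ^+ 2 + d ^+ 2) ^+ 2 * (C ^+ 2 + S ^+ 2) - ((c ^+ 2 - d ^+ 2)
    * C + 2 * c * d * S) ^+ 2); first by rewrite h subrK mulr1.
  by ring.
rewrite [leRHS](_ : _ = A / 2 * th + (2 * n%:R)^-1 * (sin (n%:R * th) * B)); last first.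
  rewrite -/th -/psi in E1 E2.
  rewrite /B (mulrDr (sin (n%:R * th))) !(mulrCA (sin (n%:R * th))) -E1 -E2 /A /th;
    field; exact: n0R.
have key : - (n%:R * `|sin th| * A) <= sin (n%:R * th) * B.
  rewrite lerNl (le_trans (ler_norm _))// normrN normrM ler_pM//.
  exact: norm_sin_natmul_le.
have inv0 : 0 <= (2 * n%:R)^-1 :> R by rewrite invr_ge0 mulr_ge0.
rewrite (le_trans _ (lerD (lexx _) (ler_wpM2l inv0 key)))// -subr_ge0.
by rewrite [leRHS](_ : _ = 0)//; field; exact: n0R.
Qed.

End Trigonometry.

(** * Fourier uniqueness on the circle *)

Section StepPolynomials.
Variable R : realType.
Implicit Types (x : R) (n : nat).

(** By Bernoulli's inequality these polynomials converge on [[0, 1]], boundedly,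
    to the indicator of [[0, 1/2[] except at [1/2]. *)
Definition step_poly n x : R := (1 - x ^+ n) ^+ (2 ^ n).

Lemma bernoulli_le x n : -1 <= x -> 1 + n%:R * x <= (1 + x) ^+ n.
Proof.
move=> x1; elim: n => [|n IHn]; first by rewrite mul0r addr0 expr0.
rewrite exprS; have x10 : 0 <= 1 + x by lra.
apply: (le_trans _ (ler_wpM2l x10 IHn)); rewrite -natr1 -subr_ge0.
rewrite [leRHS](_ : _ = n%:R * x ^+ 2); last ring.
by rewrite mulr_ge0// sqr_ge0.
Qed.

Lemma step_poly_ge0 n x : 0 <= x <= 1 -> 0 <= step_poly n x.
Proof. by move=> /andP[x0 x1]; rewrite exprn_ge0// subr_ge0 exprn_ile1. Qed.

Lemma step_poly_le1 n x : 0 <= x <= 1 -> step_poly n x <= 1.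
Proof.
move=> /andP[x0 x1]; rewrite exprn_ile1 ?subr_ge0 ?exprn_ile1//.
by rewrite gerBl exprn_ge0.
Qed.

Lemma cvg_step_poly1 x : 0 <= x < 1 / 2 -> step_poly n x @[n --> \oo] --> (1 : R).
Proof.
move=> /andP[x0 x12].
have lim1 : 1 - (2 * x) ^+ n @[n --> \oo] --> (1 : R).
  rewrite -[X in _ --> X]subr0; apply: cvgB; first exact: cvg_cst.
  by apply: cvg_expr; rewrite ger0_norm; lra.
apply: (@squeeze_cvgr _ _ _ _ (fun n => 1 - (2 * x) ^+ n) (cst 1) _ _ _ lim1);
  last exact: cvg_cst.
apply: nearW => n; apply/andP; split; last by apply: step_poly_le1; lra.
rewrite exprMn -natrX -mulrN; apply: bernoulli_le.
by rewrite lerN2 exprn_ile1//; lra.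
Qed.

Lemma cvg_step_poly0 x : 1 / 2 < x <= 1 -> step_poly n x @[n --> \oo] --> (0 : R).
Proof.
move=> /andP[x12 x1]; have x0 : 0 < x by lra.
have lim0 : ((2 * x)^-1) ^+ n @[n --> \oo] --> (0 : R).
  apply: cvg_expr; rewrite ger0_norm ?invr_ge0; last lra.
  by rewrite invf_lt1; lra.
apply: (@squeeze_cvgr _ _ _ _ (cst 0) (fun n => ((2 * x)^-1) ^+ n) _ _ _ _ lim0);
  last exact: cvg_cst.
apply: nearW => n; apply/andP; split; first by apply: step_poly_ge0; lra.
set u := x ^+ n; have u0 : 0 < u by rewrite exprn_gt0.
have u1 : u <= 1 by rewrite exprn_ile1// ltW.
rewrite exprVn -div1r ler_pdivlMr ?exprn_gt0 ?mulr_gt0// exprMn -/u -natrX mulrA.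
(* Bernoulli bounds 2^n u by (1 + u)^(2^n), and (1 - u)(1 + u) <= 1. *)
have h : (2 ^ n)%:R * u <= (1 + u) ^+ (2 ^ n).
  by apply: le_trans (bernoulli_le _ _); [rewrite lerDr|lra].
have s0 : 0 <= (1 - u) ^+ (2 ^ n) by rewrite exprn_ge0// subr_ge0.
rewrite -mulrA (le_trans (ler_wpM2l s0 h))// -exprMn exprn_ile1//.
  by rewrite mulr_ge0; lra.
by rewrite (_ : _ * _ = 1 - u ^+ 2); [rewrite gerBl sqr_ge0|ring].
Qed.
End StepPolynomials.

Section FourierUniqueness.
Variable R : realType.
Local Notation lam := (@lebesgue_measure R).
Local Notation circle := (`[- pi, pi]%classic : set (measurableTypeR R)).
Implicit Types (f g : R -> R) (c : R).
#[local] Hint Resolve measurable_circle : core.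

(** The arbitrary phase covers cosine and sine coefficients at once, and absorbs the
    shift [c] of the multipliers [cos (y - c)] used below. *)
Definition fourier_null f :=
  lam.-integrable circle (EFin \o f) /\
  forall n phi, \int[lam]_(y in circle) (f y * cos (n%:R * y + phi)) = 0.

Lemma measurable_cos_affine k phi :
  measurable_fun [set: measurableTypeR R] (fun y : R => cos (k * y + phi)).
Proof.
apply: continuous_measurable_fun => y.
apply: (@continuous_comp _ _ _ (fun y => k * y + phi) cos); last exact: continuous_cos.
by apply: cvgD; [apply: cvgM; [exact: cvg_cst|exact: cvg_id]|exact: cvg_cst].
Qed.

Lemma integrable_mul_cos f k phi (D : set (measurableTypeR R)) : measurable D ->
  lam.-integrable D (EFin \o f) ->
  lam.-integrable D (EFin \o (fun y => f y * cos (k * y + phi))).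
Proof.
move=> mD; apply: integrable_mul_le1 => //; last by move=> y; exact: cos_max.
by apply: measurable_funTS; exact: measurable_cos_affine.
Qed.

Lemma fourier_null_lin f g k1 k2 : fourier_null f -> fourier_null g ->
  fourier_null (fun y => k1 * f y + k2 * g y).
Proof.
move=> [fi f0] [gi g0].
split.
  by apply: integrable_add => //; exact: integrable_scale.
move=> n phi.
under eq_Rintegral do rewrite mulrDl -!mulrA.
have fci := integrable_mul_cos n%:R phi (@measurable_circle R) fi.
have gci := integrable_mul_cos n%:R phi (@measurable_circle R) gi.
rewrite RintegralD//; [|exact: integrable_scale..].
by rewrite !RintegralZl// f0 g0 !mulr0 addr0.
Qed.

(** A product of cosines is a sum of two cosines of neighbouring frequencies.  At
    [n = 0] the lower frequency would be [-1]; parity of the cosine turns it into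
    [1] with the opposite phase. *)
Lemma fourier_null_mul_cos f c : fourier_null f ->
  fourier_null (fun y => f y * cos (y - c)).
Proof.
move=> [fi f0]; split.
  rewrite (_ : (fun y => _) = (fun y => f y * cos (1 * y + - c))).
    exact: integrable_mul_cos.
  by apply/funext => y; rewrite mul1r.
move=> n phi.
have prod (x y : R) : cos x * cos y = 2^-1 * (cos (x + y) + cos (y - x)).
  by rewrite cosD cosB; field.
have E y : f y * cos (y - c) * cos (n%:R * y + phi) =
    2^-1 * (f y * cos (n.+1%:R * y + (phi - c))) +
    2^-1 * (f y * (if n is m.+1 then cos (m%:R * y + (phi + c))
             else cos (1%:R * y + (- phi - c)))).
  rewrite -mulrA prod mulrCA -mulrDr; congr (_ * _); rewrite -mulrDr;
    congr (_ * (cos _ + _)).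
    by rewrite -natr1; ring.
  case: n => [|n]; first by rewrite -cosN; congr cos; ring.
  by congr cos; rewrite -natr1; ring.
under eq_Rintegral do rewrite E.
have [fi1 fi2] : lam.-integrable circle (EFin \o (fun y =>
  f y * cos (n.+1%:R * y + (phi - c)))) /\
   lam.-integrable circle (EFin \o (fun y =>
     f y * (if n is m.+1 then cos (m%:R * y + (phi + c))
             else cos (1%:R * y + (- phi - c))))).
  split; first exact: integrable_mul_cos.
  by case: n {E} => [|n]; exact: integrable_mul_cos.
rewrite RintegralD//; [|exact: integrable_scale..].
by rewrite !RintegralZl// f0 mulr0 add0r; case: n {E fi1 fi2} => [|n]; rewrite f0 mulr0.
Qed.

Lemma fourier_null_mul_step f c k0 k1 n : fourier_null f ->
  fourier_null (fun y => f y * step_poly n (k0 + k1 * cos (y - c))).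
Proof.
pose x (y : R) := k0 + k1 * cos (y - c).
have Zx g : fourier_null g -> fourier_null (fun y => g y * x y).
  move=> Zg; have := fourier_null_lin k0 k1 Zg (fourier_null_mul_cos c Zg).
  by congr fourier_null; apply/funext => y; rewrite /x; ring.
have Zxn g i : fourier_null g -> fourier_null (fun y => g y * x y ^+ i).
  move=> Zg; elim: i => [|i /Zx].
    by under eq_fun do rewrite expr0 mulr1.
  by congr fourier_null; apply/funext => y; rewrite exprSr mulrA.
have Z1xn g : fourier_null g -> fourier_null (fun y => g y * (1 - x y ^+ n)).
  move=> Zg; have := fourier_null_lin 1 (-1) Zg (Zxn _ n Zg).
  by congr fourier_null; apply/funext => y; ring.
move=> Zf; rewrite /step_poly; elim: (2 ^ n)%N => [|i /Z1xn].
  by under eq_fun do rewrite expr0 mulr1.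
by congr fourier_null; apply/funext => y; rewrite exprSr mulrA.
Qed.

Lemma cos_lt_inner (delta t : R) : 0 < delta < pi -> - delta < t < delta ->
  cos delta < cos t.
Proof.
move=> /andP[d0 dpi]; rewrite -ltr_norml => td.
rewrite -(cos_norm t) ltr_cos ?in_itv//= ?normr_ge0 ?ltW//=.
exact: lt_trans td dpi.
Qed.

Lemma cos_lt_outer (delta t : R) : 0 < delta < pi -> delta < t < 2 * pi - delta ->
  cos t < cos delta.
Proof.
move=> /andP[d0 dpi] /andP[dt t2]; have [tpi|tpi] := leP t pi.
  by rewrite ltr_cos ?in_itv/=; lra.
have -> : cos t = cos (2 * pi - t) by rewrite -cosN -cosD2pi; congr cos; ring.
by rewrite ltr_cos ?in_itv/=; lra.
Qed.

(** The arc from [- pi] to [q] has midpoint [c] and half-length [delta], so its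
    interior is the set where [cos (y - c) > cos delta].  The affine function [x] of
    [cos (y - c)] has values in [[0, 1]] and is below [1/2] exactly there,
    so [step_poly n (x y)] converges to the indicator of the arc, and dominated
    convergence applies. *)
Lemma fourier_null_initial_arc f q : fourier_null f -> - pi < q < pi ->
  \int[lam]_(y in `[- pi, q]) f y = 0.
Proof.
move=> Zf qpi; pose delta := (q + pi) / 2; pose c := (q - pi) / 2.
have d0 : 0 < delta < pi by rewrite /delta; lra.
pose x (y : R) := (1 / 2 + cos delta / 4) + (- (1 / 4)) * cos (y - c).
pose g n y := f y * step_poly n (x y).
have Zg n : fourier_null (g n) by exact: fourier_null_mul_step.
have gi n : lam.-integrable circle (EFin \o g n) by case: (Zg n).
have g0 n : (\int[lam]_(y in circle) (g n y)%:E = 0)%E.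
  rewrite -[LHS]fineK; last exact: integrable_fin_num (gi n).
  (* Orthogonality to the constant is the case n = 0, phi = 0. *)
  case: (Zg n) => _ /(_ 0%N 0) h; congr EFin; rewrite -[RHS]h.
  by rewrite /Rintegral; congr fine; apply: eq_integral => y _;
    rewrite mul0r addr0 cos0 mulr1.
have fi : lam.-integrable circle (EFin \o f) by case: Zf.
have mf : measurable_fun circle f by apply/measurable_EFinP; exact: measurable_int fi.
have xle y : 0 <= x y <= 1.
  by rewrite /x; have := cos_le1 delta; have := cos_geN1 delta;
    have := cos_le1 (y - c); have := cos_geN1 (y - c); lra.
pose A : set (measurableTypeR R) := `[- pi, q]%classic.
pose h y := f y * \1_A y.
have [] := @dominated_convergence _ _ _ lam circle (@measurable_circle R)
  (fun n => EFin \o g n) (EFin \o h) (fun y => `|f y|%:E).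
- by move=> n; exact: measurable_int (gi n).
- apply/measurable_EFinP; apply: measurable_funM => //.
  by apply: measurable_indic; exact: measurable_itv.
- (* The limit can fail at the ends of the arc, where x y = 1/2, and at pi,
     which on the circle is the end - pi. *)
  exists [set - pi; q; pi]; split.
  + by apply: measurableU; [apply: measurableU|]; exact: measurable_set1.
  + by apply: countable_lebesgue_measure0; apply/finite_set_countable;
      rewrite !finite_setU; do !split; exact: finite_set1.
  + move=> y /= /not_implyP[]; rewrite in_itv/= => /andP[y1 y2] ncv.
    apply: contrapT => /not_orP[/not_orP[/eqP yNpi /eqP yq] /eqP ypi]; apply: ncv.
    have [y1' y2'] : - pi < y /\ y < pi by rewrite !lt_neqAle y1 y2 ypi eq_sym yNpi.
    apply: cvg_EFin; first by near=> n.
    rewrite /h /g; apply: cvgM; first exact: cvg_cst.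
    rewrite indicE; have [yltq|] := ltP y q.
      rewrite mem_set /A/= ?in_itv/= ?y1 ?ltW//.
      apply: cvg_step_poly1; have := xle y; rewrite /x => /andP[-> _] /=.
      by have := @cos_lt_inner delta (y - c) d0; rewrite /delta /c; lra.
    rewrite le_eqVlt eq_sym (negPf yq)/= => qlty.
    rewrite memNset; last by rewrite /A/= in_itv/= y1 leNgt qlty.
    apply: cvg_step_poly0; have := xle y; rewrite /x => /andP[_ ->] /=.
    by have := @cos_lt_outer delta (y - c) d0; rewrite /delta /c; lra.
- exact: (integrable_abse fi).
- apply: aeW => y n _ /=; rewrite lee_fin normrM -[leRHS]mulr1 ler_wpM2l//.
  by rewrite ger0_norm; [exact: step_poly_le1|exact: step_poly_ge0].
move=> hi _ hcv.
have : (\int[lam]_(y in circle) (h y)%:E = 0)%E.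
  apply/esym; move/cvg_lim : hcv => <-//.
  by under eq_fun do rewrite g0; rewrite lim_cst.
move=> h0; have -> : `[- pi, q]%classic = circle `&` A.
  by apply/seteqP; split => [y|y []]//=; rewrite /A/= !in_itv/=; lra.
rewrite Rintegral_mkcondr /Rintegral -[RHS]/(fine 0) -h0; congr fine.
apply: eq_integral => y _; rewrite /h patchE indicE.
by case: ifP; rewrite ?mulr1 ?mulr0.
Unshelve. all: by end_near. Qed.

(** The primitive of [f] from [- pi] vanishes, and almost everywhere its derivative
    is [f]. *)
Lemma fourier_null_ae0 f : fourier_null f ->
  {ae lam, forall y, circle y -> f y = 0}.
Proof.
move=> Zf; have fi : lam.-integrable circle (EFin \o f) by case: Zf.
pose g : R -> R := f \_ circle.
have gi (D : set (measurableTypeR R)) : measurable D -> lam.-integrable D (EFin \o g).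
  move=> mD; apply: (integrableS measurableT) => //.
  by rewrite /g -restrict_EFin; apply/integrable_restrict => //; rewrite setTI.
have := @FTC1 R g (BLeft (- pi)) (fun y =>
  gi _ (measurable_itv _)) (integrable_locally (@measurable_circle R) fi).
have : {ae lam, forall y, y <> - pi /\ y <> pi}.
  exists [set - pi; pi]; split.
  - by apply: measurableU; exact: measurable_set1.
  - by apply: countable_lebesgue_measure0; apply/finite_set_countable;
      rewrite finite_setU; split; exact: finite_set1.
  - by move=> y /= /not_andP[] /contrapT ->; [left|right].
apply: filterS2; first exact: (ae_filter_ringOfSetsType lam).
move=> y [yN yp] /= FTC; rewrite in_itv/= => /andP[y1 y2].
have ygt : - pi < y by rewrite lt_neqAle y1 andbT eq_sym; apply/eqP.
have ylt : y < pi by rewrite lt_neqAle y2 andbT; apply/eqP.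
have [_] := FTC ygt.
rewrite {2}/g patchE mem_set /= ?in_itv/= ?y1// => <-.
rewrite derive1E (near_eq_derive (g := cst 0)).
  by rewrite derive_cst.
near=> z.
have z1 : - pi < z by near: z; exact: lt_nbhsr.
have z2 : z < pi by near: z; exact: lt_nbhsl.
rewrite -[RHS](fourier_null_initial_arc Zf (q := z)) ?z1//.
apply: eq_Rintegral => t; rewrite inE/= in_itv/= => /andP[t1 t2].
by rewrite /g patchE mem_set//= in_itv/= t1 (le_trans t2)// ltW.
Unshelve. all: by end_near. Qed.
End FourierUniqueness.

(** * Square-integrable functions on the cylinder *)

Section Strips.
Variable R : realType.
Local Notation lam := (@lebesgue_measure R).
Local Notation plane := (measurableTypeR R * measurableTypeR R)%type.
Local Notation circle := (`[- pi, pi]%classic : set (measurableTypeR R)).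
Implicit Types (I : set (measurableTypeR R)).

Lemma area_ae_filter : Filter (almost_everywhere (@area R)).
Proof. exact: ae_filter_ringOfSetsType. Qed.

Lemma measurable_strip I : measurable I -> measurable (strip I : set plane).
Proof.
move=> mI; rewrite (_ : strip I = [set: measurableTypeR R] `*` I).
  exact: measurableX.
by apply/seteqP; split => -[x y]//= [].
Qed.

Lemma measurable_cylinder : measurable (cylinder : set plane).
Proof. exact: measurable_strip (@measurable_circle R). Qed.

Lemma ge0_integral_strip I (f : R * R -> \bar R) : measurable I ->
  measurable_fun [set: plane] f -> (forall z, 0 <= f z)%E ->
  (\int[area]_(z in strip I) f z =
   \int[lam]_x \int[lam]_(y in I) f (x, y))%E.
Proof.
move=> mI mf f0; rewrite integral_mkcond /area fubini_tonelli1.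
- apply: eq_integral => x _; rewrite [RHS]integral_mkcond.
  apply: eq_integral => y _; rewrite !patchE; congr (if _ then _ else _).
- apply/(measurable_restrictT _ _).1; first exact: measurable_strip.
  exact: measurable_funTS.
- by move=> z; rewrite patchE; case: ifP.
Qed.

Definition yshift (s : R) (z : R * R) : R * R := (z.1, z.2 + s).

Lemma measurable_yshift s : measurable_fun [set: plane] (yshift s : plane -> plane).
Proof.
apply: (measurable_fun_pair (f := (fst : plane -> measurableTypeR R))) => //.
exact: (measurableT_comp (measurable_shift s)).
Qed.

Lemma measurable_slice (f : R * R -> R) x : measurable_fun [set: plane] f ->
  measurable_fun [set: measurableTypeR R] (fun y => f (x, y)).
Proof. by move=> mf; exact: measurableT_comp mf (measurable_pair1 _). Qed.
End Strips.

Section AreaSigmaFinite.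
Variable R : realType.
Local Notation lam := (@lebesgue_measure R).
Local Notation plane := (measurableTypeR R * measurableTypeR R)%type.

(** A copy of the area that carries the sigma-finite structure required by Fubini's
    theorem on a product with the plane. *)
Definition plane_measure : set plane -> \bar R := area.
HB.instance Definition _ := Measure.copy plane_measure (area : set plane -> \bar R).

Lemma plane_measure_sigma_finite : sigma_finite [set: plane] plane_measure.
Proof.
pose I n : set (measurableTypeR R) := `[- n%:R, n%:R]%classic.
have mI n : measurable (I n) by exact: measurable_itv.
exists (fun n => I n `*` I n).
  apply/esym/seteqP; split => // -[x y] _.
  have [n xn] : exists n, `|x| + `|y| <= n%:R.
    by exists (Num.bound (`|x| + `|y|)); rewrite ltW// archi_boundP// addr_ge0.
  have x0 := normr_ge0 x; have y0 := normr_ge0 y.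
  exists n => //; split; rewrite /I /= in_itv/= -ler_norml; lra.
move=> n; split; first exact: measurableX.
rewrite /plane_measure /area /= product_measure1E//.
have [r Ir] : exists r, lam (I n) = r%:E.
  by rewrite /I lebesgue_measure_itv/=; case: ifP => _; [exists (n%:R - - n%:R)|exists 0].
by rewrite -[X in (X < _)%E]/(lam (I n) * lam (I n))%E Ir -EFinM ltry.
Qed.

HB.instance Definition _ := @Measure_isSigmaFinite.Build _ _ _ plane_measure
  plane_measure_sigma_finite.
End AreaSigmaFinite.

Section RealL2.
Variable R : realType.
Local Notation lam := (@lebesgue_measure R).
Local Notation plane := (measurableTypeR R * measurableTypeR R)%type.
Local Notation circle := (`[- pi, pi]%classic : set (measurableTypeR R)).
Implicit Types (f g h : R * R -> R) (k s : R).
#[local] Hint Resolve measurable_circle measurable_cylinder : core.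

Definition yperiodic f := forall x y, f (x, y + 2 * pi) = f (x, y).

Lemma ge0_integral_cylinder_shift s (f : R * R -> \bar R) :
  `|s| <= 2 * pi -> measurable_fun [set: plane] f -> (forall z, 0 <= f z)%E ->
  (forall x y, f (x, y + 2 * pi) = f (x, y)) ->
  (\int[area]_(z in cylinder) f (yshift s z) = \int[area]_(z in cylinder) f z)%E.
Proof.
move=> s2 mf f0 fper; have mfs := measurableT_comp mf (measurable_yshift s).
rewrite (ge0_integral_strip (@measurable_circle R) mf f0).
rewrite (ge0_integral_strip (@measurable_circle R) mfs (fun z => f0 _)).
apply: eq_integral => x _; rewrite /yshift/=.
apply: (@ge0_integral_periodic_shift R s (fun y => f (x, y))) => //.
exact: measurableT_comp mf (measurable_pair1 _).
Qed.

Lemma Rintegral_cylinder_shift s f :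
  `|s| <= 2 * pi -> measurable_fun [set: plane] f -> yperiodic f ->
  \int[area]_(z in cylinder) f (yshift s z) = \int[area]_(z in cylinder) f z.
Proof.
move=> s2 mf fper; rewrite /Rintegral; congr fine.
rewrite integralE [RHS]integralE.
have mfE : measurable_fun [set: plane] (EFin \o f) by exact/measurable_EFinP.
have hp := @ge0_integral_cylinder_shift s ((EFin \o f)^\+)%E s2 (measurable_funepos mfE).
have hn := @ge0_integral_cylinder_shift s ((EFin \o f)^\-)%E s2 (measurable_funeneg mfE).
congr (_ - _)%E.
- by rewrite -[RHS]hp => [|z|x y]; [by apply: eq_integral => z _;
    rewrite !funeposE|exact: funepos_ge0|rewrite !funeposE /= fper].
- by rewrite -[RHS]hn => [|z|x y]; [by apply: eq_integral => z _;
    rewrite !funenegE|exact: funeneg_ge0|rewrite !funenegE /= fper].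
Qed.

Lemma Rintegral_circle_shift s (f : R -> R) :
  `|s| <= 2 * pi -> measurable_fun [set: measurableTypeR R] f ->
  (forall y, f (y + 2 * pi) = f y) ->
  \int[lam]_(y in circle) f (y + s) = \int[lam]_(y in circle) f y.
Proof.
move=> s2 mf fper; rewrite /Rintegral; congr fine.
rewrite integralE [RHS]integralE.
have mfE : measurable_fun [set: measurableTypeR R] (EFin \o f) by exact/measurable_EFinP.
have hp := @ge0_integral_periodic_shift R s ((EFin \o f)^\+)%E s2 (measurable_funepos
  mfE).
have hn := @ge0_integral_periodic_shift R s ((EFin \o f)^\-)%E s2 (measurable_funeneg
  mfE).
congr (_ - _)%E.
- by rewrite -[RHS]hp => [|z|y]; [by apply: eq_integral => z _;
    rewrite !funeposE|exact: funepos_ge0|rewrite !funeposE /= fper].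
- by rewrite -[RHS]hn => [|z|y]; [by apply: eq_integral => z _;
    rewrite !funenegE|exact: funeneg_ge0|rewrite !funenegE /= fper].
Qed.

Definition real_L2 f := [/\ yperiodic f, measurable_fun [set: plane] f
  & (\int[area]_(z in cylinder) (f z ^+ 2)%:E < +oo)%E].

Definition real_L20 f := real_L2 f /\
  {ae lam, forall x, \int[lam]_(y in circle) f (x, y) = 0}.

Definition ip f g := \int[area]_(z in cylinder) (f z * g z).

Lemma ge0_le_integral_cylinder (f g : R * R -> R) :
  measurable_fun [set: plane] f -> measurable_fun [set: plane] g ->
  (forall z, 0 <= f z <= g z) ->
  (\int[area]_(z in cylinder) (f z)%:E <= \int[area]_(z in cylinder) (g z)%:E)%E.
Proof.
move=> mf mg fg; apply: ge0_le_integral => //.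
- by move=> z _; rewrite lee_fin; case/andP: (fg z).
- by apply/measurable_EFinP; exact: measurable_funTS.
- by apply/measurable_EFinP; exact: measurable_funTS.
- by move=> z _; rewrite lee_fin; case/andP: (fg z).
Qed.

Lemma integral_cylinder_sum_lty (f g : R * R -> R) :
  measurable_fun [set: plane] f -> measurable_fun [set: plane] g ->
  (forall z, 0 <= f z) -> (forall z, 0 <= g z) ->
  (\int[area]_(z in cylinder) (f z)%:E < +oo)%E ->
  (\int[area]_(z in cylinder) (g z)%:E < +oo)%E ->
  (\int[area]_(z in cylinder) (f z + g z)%:E < +oo)%E.
Proof.
move=> mf mg f0 g0 fi gi; under eq_integral do rewrite EFinD.
rewrite ge0_integralD; first exact: lte_add_pinfty.
- exact: measurable_cylinder.
- by move=> z _; rewrite lee_fin.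
- by apply/measurable_EFinP; exact: measurable_funTS.
- by move=> z _; rewrite lee_fin.
- by apply/measurable_EFinP; exact: measurable_funTS.
Qed.

Lemma real_L2_integrable_mul f g : real_L2 f -> real_L2 g ->
  area.-integrable (cylinder : set plane) (EFin \o (fun z => f z * g z)).
Proof.
move=> [_ mf fi] [_ mg gi]; apply/integrableP; split.
  by apply/measurable_EFinP; apply: measurable_funTS; exact: measurable_funM.
apply: le_lt_trans (integral_cylinder_sum_lty _ _ _ _ fi gi) => /=.
- under eq_integral do rewrite /=.
  apply: ge0_le_integral_cylinder.
  + by apply: measurableT_comp => //; exact: measurable_funM.
  + by apply: measurable_funD; exact: measurable_funX.
  + move=> z; rewrite normr_ge0/= normrM.
    rewrite -(real_normK (num_real (f z))) -(real_normK (num_real (g z))).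
    have := normr_ge0 (f z); have := normr_ge0 (g z).
    move: `|f z| `|g z| => p q p0 q0.
    have : 0 <= (p - q) ^+ 2 by exact: sqr_ge0.
    have : 0 <= p * q by rewrite mulr_ge0.
    by nra.
- exact: measurable_funX.
- exact: measurable_funX.
- by move=> z; exact: sqr_ge0.
- by move=> z; exact: sqr_ge0.
Qed.

Lemma real_L2_lin k1 k2 f g : real_L2 f -> real_L2 g ->
  real_L2 (fun z => k1 * f z + k2 * g z).
Proof.
move=> [fp mf fi] [gp mg gi]; split.
- by move=> x y; rewrite fp gp.
- by apply: measurable_funD; apply: measurable_funM => //; exact: measurable_cst.
have scl (k : R) h : measurable_fun [set: plane] h ->
    (\int[area]_(z in cylinder) (h z ^+ 2)%:E < +oo)%E ->
    (\int[area]_(z in cylinder) (2 * k ^+ 2 * h z ^+ 2)%:E < +oo)%E.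
  move=> mh hi; under eq_integral do rewrite EFinM.
  rewrite ge0_integralZl.
  - by rewrite lte_mul_pinfty// lee_fin mulr_ge0 ?sqr_ge0.
  - exact: measurable_cylinder.
  - by apply/measurable_EFinP; apply: measurable_funTS; exact: measurable_funX.
  - by move=> z _; rewrite lee_fin sqr_ge0.
  - by rewrite lee_fin mulr_ge0 ?sqr_ge0.
apply: le_lt_trans (integral_cylinder_sum_lty _ _ _ _ (scl k1 _ mf fi) (scl k2 _ mg gi)).
- apply: ge0_le_integral_cylinder.
  + apply: measurable_funX; apply: measurable_funD; apply: measurable_funM => //;
      exact: measurable_cst.
  + by apply: measurable_funD; (apply: measurable_funM;
      [exact: measurable_cst|exact: measurable_funX]).
  + move=> z; rewrite sqr_ge0/= -subr_ge0.
    rewrite [leRHS](_ : _ = (k1 * f z - k2 * g z) ^+ 2) ?sqr_ge0//; ring.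
- by apply: measurable_funM; [exact: measurable_cst|exact: measurable_funX].
- by apply: measurable_funM; [exact: measurable_cst|exact: measurable_funX].
- by move=> z; rewrite -mulrA mulr_ge0// -exprMn sqr_ge0.
- by move=> z; rewrite -mulrA mulr_ge0// -exprMn sqr_ge0.
Qed.

Lemma ipDl f g h : real_L2 f -> real_L2 g -> real_L2 h ->
  ip (fun z => f z + g z) h = ip f h + ip g h.
Proof.
move=> Lf Lg Lh; rewrite /ip; under eq_Rintegral do rewrite mulrDl.
by rewrite RintegralD//; exact: real_L2_integrable_mul.
Qed.

Lemma ipC f g : ip f g = ip g f.
Proof. by rewrite /ip; under eq_Rintegral do rewrite mulrC. Qed.

Lemma ipZl k f g : real_L2 f -> real_L2 g ->
  ip (fun z => k * f z) g = k * ip f g.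
Proof.
move=> Lf Lg; rewrite /ip; under eq_Rintegral do rewrite -mulrA.
by rewrite RintegralZl//; exact: real_L2_integrable_mul.
Qed.

Lemma real_L2_shift s f : `|s| <= 2 * pi -> real_L2 f -> real_L2 (f \o yshift s).
Proof.
move=> s2 [fp mf fi]; split.
- by move=> x y; rewrite /yshift/= addrAC fp.
- exact: measurableT_comp mf (measurable_yshift s).
rewrite (@ge0_integral_cylinder_shift s (fun z => (f z ^+ 2)%:E))//.
- by apply/measurable_EFinP; exact: measurable_funX.
- by move=> z; rewrite lee_fin sqr_ge0.
- by move=> x y; rewrite fp.
Qed.

Lemma real_L20_shift s f : `|s| <= 2 * pi -> real_L20 f -> real_L20 (f \o yshift s).
Proof.
move=> s2 [Lf f0]; split; first exact: real_L2_shift.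
move: f0; apply: filterS; first exact: (ae_filter_ringOfSetsType lam).
move=> x <-; case: Lf => fp mf _.
by rewrite -(@Rintegral_circle_shift s (fun y => f (x, y)))//; exact: measurable_slice.
Qed.

Lemma ip_shift s f g : `|s| <= 2 * pi -> real_L2 f -> real_L2 g ->
  ip (f \o yshift s) (g \o yshift s) = ip f g.
Proof.
move=> s2 [fp mf _] [gp mg _].
apply: (@Rintegral_cylinder_shift s (fun z => f z * g z)) => //.
  exact: measurable_funM.
by move=> x y; rewrite fp gp.
Qed.
End RealL2.

Section Slices.
Variable R : realType.
Local Notation lam := (@lebesgue_measure R).
Local Notation plane := (measurableTypeR R * measurableTypeR R)%type.
Local Notation circle := (`[- pi, pi]%classic : set (measurableTypeR R)).
Implicit Types (f g h : R * R -> R) (k s : R).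
#[local] Hint Resolve measurable_circle measurable_cylinder : core.

Lemma measurable_integral_slice (D : set (measurableTypeR R)) (f : R * R -> \bar R) :
  measurable D -> measurable_fun [set: plane] f -> (forall z, 0 <= f z)%E ->
  measurable_fun [set: measurableTypeR R] (fun x => \int[lam]_(y in D) f (x, y))%E.
Proof.
move=> mD mf f0.
have mfD : measurable_fun [set: plane] (f \_ (strip D)).
  apply/(measurable_restrictT _ _).1; first exact: measurable_strip.
  exact: measurable_funTS.
rewrite [X in measurable_fun _ X](_ : _ = fubini_F lam (f \_ (strip D))).
  by apply: measurable_fun_fubini_tonelli_F => // z; rewrite patchE; case: ifP.
apply/funext => x; rewrite /fubini_F [LHS]integral_mkcond.
by apply: eq_integral => y _; rewrite !patchE; congr (if _ then _ else _).
Qed.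

Lemma integral_strip_sqr (I : set (measurableTypeR R)) f : measurable I ->
  measurable_fun [set: plane] f ->
  (\int[area]_(z in strip I) (f z ^+ 2)%:E =
   \int[lam]_x \int[lam]_(y in I) (f (x, y) ^+ 2)%:E)%E.
Proof.
move=> mI mf; apply: (@ge0_integral_strip R I (fun z => (f z ^+ 2)%:E)) => //.
  by apply/measurable_EFinP; exact: measurable_funX.
by move=> z; rewrite lee_fin sqr_ge0.
Qed.

Lemma ae_cylinder_eq0 f : measurable_fun [set: plane] f ->
  (\int[area]_(z in cylinder) (f z ^+ 2)%:E = 0)%E <->
  {ae area, forall z, cylinder z -> f z = 0}.
Proof.
move=> mf.
have mfc : measurable_fun (cylinder : set plane) (fun z => (f z ^+ 2)%:E).
  by apply/measurable_EFinP; apply: measurable_funTS; exact: measurable_funX.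
have := ae_eq_integral_abs area (@measurable_cylinder R) mfc.
under eq_integral do rewrite gee0_abs ?lee_fin ?sqr_ge0//.
move=> [h1 h2]; split=> [/h1|h].
  apply: (@filterS _ _ (@area_ae_filter R)) => z /= H /H [].
  by move=> /eqP; rewrite sqrf_eq0 => /eqP.
apply: h2; move: h; apply: (@filterS _ _ (@area_ae_filter R)) => z H /H ->.
by rewrite expr0n.
Qed.

Lemma ae_slice_sqr_lty f : real_L2 f ->
  {ae lam, forall x, (\int[lam]_(y in circle) (f (x, y) ^+ 2)%:E < +oo)%E}.
Proof.
move=> [_ mf fi].
have mf2 : measurable_fun [set: plane] (fun z => (f z ^+ 2)%:E).
  by apply/measurable_EFinP; exact: measurable_funX.
have f20 z : (0 <= (f z ^+ 2)%:E)%E by rewrite lee_fin sqr_ge0.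
rewrite (integral_strip_sqr (@measurable_circle R) mf) in fi.
have : lam.-integrable setT (fun x => \int[lam]_(y in circle) (f (x, y) ^+ 2)%:E)%E.
  apply/integrableP; split.
    exact: (@measurable_integral_slice circle (fun z => (f z ^+ 2)%:E)).
  by under eq_integral do rewrite gee0_abs ?integral_ge0//.
move/integrable_ae => /(_ measurableT).
apply: filterS.
by move=> x /(_ I); rewrite ge0_fin_numE// integral_ge0.
Qed.

(** The circle has finite measure, and [|t| <= 1 + t ^+ 2]. *)
Lemma sqr_lty_integrable (f : R -> R) : measurable_fun [set: measurableTypeR R] f ->
  (\int[lam]_(y in circle) (f y ^+ 2)%:E < +oo)%E ->
  lam.-integrable circle (EFin \o f).
Proof.
move=> mf fi.
have i1 : lam.-integrable circle (EFin \o (fun y => f y ^+ 2)).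
  apply/integrableP; split.
    by apply/measurable_EFinP; apply: measurable_funTS; exact: measurable_funX.
  by under eq_integral do rewrite /= ger0_norm ?sqr_ge0//.
have i2 := @integrable_circle_cst R 1.
have := integrable_add (@measurable_circle R) i1 i2.
apply: le_integrable => //.
  by apply/measurable_EFinP; exact: measurable_funTS.
move=> y _ /=; rewrite lee_fin [leRHS]ger0_norm ?addr_ge0 ?sqr_ge0//.
rewrite -(real_normK (num_real (f y))); move: `|f y| (normr_ge0 (f y)) => t t0; nra.
Qed.

Lemma ae_slice_integrable f : real_L2 f ->
  {ae lam, forall x, lam.-integrable circle (EFin \o (fun y => f (x, y)))}.
Proof.
move=> Lf; have := ae_slice_sqr_lty Lf.
apply: filterS; first exact: (ae_filter_ringOfSetsType lam).
by move=> x; apply: sqr_lty_integrable; case: Lf => _ mf _; exact: measurable_slice.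
Qed.

Lemma real_L20_lin k1 k2 f g : real_L20 f -> real_L20 g ->
  real_L20 (fun z => k1 * f z + k2 * g z).
Proof.
move=> [Lf f0] [Lg g0]; split; first exact: real_L2_lin.
have aeF := ae_filter_ringOfSetsType lam.
have fg0 := @filterS2 _ _ aeF _ _ _ (fun x p q => conj p q) f0 g0.
move: fg0 (ae_slice_integrable Lf) (ae_slice_integrable Lg).
apply: (@filterS3 _ _ aeF) => x [fx gx] ifx igx.
rewrite RintegralD//; [|exact: integrable_scale..].
by rewrite !RintegralZl// fx gx !mulr0 addr0.
Qed.
End Slices.

(** * Symmetries of the operator *)

Section Symmetries.
Local Open Scope complex_scope.
Variable R : realType.
Local Notation lam := (@lebesgue_measure R).
Local Notation plane := (measurableTypeR R * measurableTypeR R)%type.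
Local Notation circle := (`[- pi, pi]%classic : set (measurableTypeR R)).
Implicit Types (u v : R * R -> R[i]) (f g h : R * R -> R) (k s : R).
#[local] Hint Resolve measurable_circle measurable_cylinder : core.

Definition re u : R * R -> R := fun z => complex.Re (u z).
Definition im u : R * R -> R := fun z => complex.Im (u z).

Lemma complex_eqP (z w : R[i]) : complex.Re z = complex.Re w ->
  complex.Im z = complex.Im w -> z = w.
Proof. by case: z w => [a b] [c d] /= -> ->. Qed.

Lemma L2X_reim u : L2X u <-> real_L2 (re u) /\ real_L2 (im u).
Proof.
split=> [[up mr mi ui]|[[rp mr ri] [jp mi ii]]].
  split; split => //.
  - by move=> x y; rewrite /re up.
  - apply: le_lt_trans ui; apply: ge0_le_integral_cylinder.
    + exact: measurable_funX.
    + by apply: measurable_funD; exact: measurable_funX.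
    + by move=> z; rewrite sqr_ge0 lerDl sqr_ge0.
  - by move=> x y; rewrite /im up.
  - apply: le_lt_trans ui; apply: ge0_le_integral_cylinder.
    + exact: measurable_funX.
    + by apply: measurable_funD; exact: measurable_funX.
    + by move=> z; rewrite sqr_ge0 lerDr sqr_ge0.
split => //.
- by move=> x y; apply: complex_eqP; [exact: rp|exact: jp].
- apply: integral_cylinder_sum_lty => //.
  + exact: measurable_funX.
  + exact: measurable_funX.
  + by move=> z; exact: sqr_ge0.
  + by move=> z; exact: sqr_ge0.
Qed.

Lemma L20X_reim u : L20X u <-> real_L20 (re u) /\ real_L20 (im u).
Proof.
have aeF := ae_filter_ringOfSetsType lam.
split=> [[/L2X_reim[Lr Li] u0]|[[Lr r0] [Li i0]]].
  split; split => //; move: u0; apply: filterS => x; rewrite /cintegral.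
    by move=> /(congr1 (@complex.Re R)).
  by move=> /(congr1 (@complex.Im R)).
split; first by apply/L2X_reim.
by move: r0 i0; apply: filterS2 => x rx ix; apply: complex_eqP.
Qed.

Lemma L2dot_reim u v : L20X u -> L20X v ->
  L2dot u v = (ip (re u) (re v) + ip (im u) (im v)) +i*
              (ip (im u) (re v) - ip (re u) (im v)).
Proof.
move=> /L20X_reim[[ru _] [iu _]] /L20X_reim[[rv _] [iv _]].
have i1 := real_L2_integrable_mul ru rv; have i2 := real_L2_integrable_mul iu iv.
have i3 := real_L2_integrable_mul iu rv; have i4 := real_L2_integrable_mul ru iv.
rewrite /L2dot /cintegral; congr (_ +i* _).
  rewrite -RintegralD//; apply: eq_Rintegral => z _; rewrite /re /im.
  by case: (u z) (v z) => [a b] [c d] /=; rewrite mulrN opprK.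
rewrite -RintegralB//; apply: eq_Rintegral => z _; rewrite /re /im.
by case: (u z) (v z) => [a b] [c d] /=; rewrite mulrN addrC.
Qed.

(** The set [Q] of pairs whose image under [U] is in [P] is the graph of
    [U^-1 P U].  It is self-adjoint, because [U] preserves the scalar product up to
    [kappa], and it extends the operator on test functions, because [U] commutes
    with that operator; by uniqueness [Q = P].  The map [kappa] is the identity for
    unitary [U] and the conjugation for antiunitary [U]. *)
Lemma symmetry_of_operator (V : R -> R) (P : operator R)
    (U U' : (R * R -> R[i]) -> (R * R -> R[i])) (kappa : R[i] -> R[i]) :
  is_grushin_operator V P -> cancel U U' -> cancel U' U -> injective kappa ->
  (forall u, L20X u -> L20X (U u)) -> (forall u, L20X u -> L20X (U' u)) ->
  (forall u v, L20X u -> L20X v -> L2dot (U u) v = kappa (L2dot u (U' v))) ->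
  (forall u, test_function u -> test_function (U u)) ->
  (forall u, test_function u -> grushin V (U u) = U (grushin V u)) ->
  forall u v, P (u, v) -> P (U u, U v).
Proof.
move=> [[Padj Ptest] Puniq] UK U'K kinj LU LU' dotU testU grushinU u v Puv.
have PL w1 w2 : P (w1, w2) -> L20X w1 /\ L20X w2.
  by rewrite Padj => -[].
pose Q : operator R := [set uv | P (U uv.1, U uv.2)].
suff PQ : P = Q by have : Q (u, v) by rewrite -PQ.
apply: Puniq; split; last first.
  by move=> w tw; rewrite /Q/= -grushinU//; apply: Ptest; exact: testU.
have adj w1 w2 : P (w1, w2) -> forall psi chi, P (psi, chi) ->
  L2dot w1 chi = L2dot w2 psi.
  by rewrite {1}Padj => -[].
apply/seteqP; split => -[w1 w2].
  move=> /= Pw; have [Lw1 Lw2] := PL _ _ Pw.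
  split => /=; [by rewrite -(UK w1); exact: LU'|by rewrite -(UK w2); exact: LU'|].
  move=> psi chi /= Pg; have [Lpsi Lg] := PL _ _ Pg.
  have LL w : L20X (U w) -> L20X w by move=> Lw; rewrite -(UK w); exact: LU'.
  by have := adj _ _ Pw _ _ Pg; rewrite !dotU ?UK//; [exact: kinj|exact: LL|exact: LL].
move=> [/= Lw1 Lw2 Hw]; rewrite /Q/= Padj; split => /=; [exact: LU|exact: LU|].
move=> psi chi Pg; have [Lpsi Lg] := PL _ _ Pg; rewrite !dotU//; congr kappa.
by apply: Hw; rewrite /Q/= !U'K.
Qed.

Definition shift_fun s u : R * R -> R[i] := u \o yshift s.

Definition conj_fun u : R * R -> R[i] := fun z => re u z +i* (- im u z).

Lemma yshiftK s : cancel (yshift s) (yshift (- s) : R * R -> R * R).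
Proof. by move=> [x y]; rewrite /yshift/= addrK. Qed.

Lemma shift_funK s : cancel (shift_fun s) (shift_fun (- s)).
Proof.
by move=> u; apply/funext => z; rewrite /shift_fun/= -{1}(opprK s) yshiftK.
Qed.

Lemma conj_funK : involutive conj_fun.
Proof.
by move=> u; apply/funext => z; apply: complex_eqP; rewrite /conj_fun /re /im /= ?opprK.
Qed.

Lemma derive1_shift (f : R -> R) s t : derive1 (fun y => f (y + s)) t = derive1 f (t + s).
Proof.
by rewrite /derive1; under eq_fun do rewrite -addrA.
Qed.

Lemma derivable_shift (f : R -> R) s t : derivable f (t + s) 1 ->
  derivable (fun y => f (y + s)) t 1.
Proof.
by rewrite /derivable /=; under [in X in _ -> X]eq_fun do rewrite -addrA.
Qed.

Lemma slice_yshift b f s z :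
  slice b (f \o yshift s) z = (fun t => slice b f (yshift s z) (if b then t + s else t)).
Proof. by case: b. Qed.

Lemma partial_yshift b f s : partial b (f \o yshift s) = partial b f \o yshift s.
Proof.
apply/funext => z; rewrite /partial slice_yshift; case: b => //=.
exact: derive1_shift (slice true f (yshift s z)) s z.2.
Qed.

Lemma continuous_yshift s : continuous (yshift s : R * R -> R * R).
Proof.
move=> z; rewrite /yshift.
apply: (@cvg_pair _ _ _ (nbhs z) (nbhs z.1) (nbhs (z.2 + s))); first exact: cvg_fst.
by apply: cvgD; [exact: cvg_snd|exact: cvg_cst].
Qed.

Lemma smooth_yshift f s : smooth f -> smooth (f \o yshift s).
Proof.
move=> sf l; have -> : foldr (@partial R) (f \o yshift s) l = foldr (@partial R)
  f l \o yshift s.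
  by elim: l => //= b l ->; rewrite partial_yshift.
have [cf df] := sf l; split.
  by move=> z; apply: continuous_comp; [exact: continuous_yshift|exact: cf].
move=> b z; rewrite slice_yshift; have := df b (yshift s z).
case: b => dt; last exact: dt.
exact: (@derivable_shift (slice true (foldr (@partial R) f l) (yshift s z)) s z.2 dt).
Qed.

Lemma smooth_partial f b : smooth f -> smooth (partial b f).
Proof. by move=> sf l; have := sf (rcons l b); rewrite foldr_rcons. Qed.

Lemma partialN f b : smooth f -> partial b (fun z => - f z) = (fun z => - partial b f z).
Proof.
move=> sf; apply/funext => z; have [_ df] := sf [::]; have := df b z => /= dfz.
rewrite /partial (_ : slice b (fun z => - f z) z = (fun t => - slice b f z t));
  last by case: b {dfz}.
by rewrite !derive1E; exact: deriveN.
Qed.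

Lemma smoothN f : smooth f -> smooth (fun z => - f z).
Proof.
move=> sf l.
have [sl ->] : smooth (foldr (@partial R) f l) /\
   foldr (@partial R) (fun z => - f z) l = (fun z => - foldr (@partial R) f l z).
  elim: l => [|b l [sl IH]]; first by split.
  rewrite /= IH; split; [exact: smooth_partial|exact: partialN].
have [cf df] := sl [::]; split; first by move=> z; apply: cvgN; exact: cf.
move=> b z; rewrite (_ : slice b _ z = (fun t =>
  - slice b (foldr (@partial R) f l) z t)); last by case: b.
apply: derivableN; exact: df.
Qed.

Lemma cpartial_shift_fun b u s : cpartial b (shift_fun s u) = shift_fun s (cpartial b u).
Proof.
have pe f := congr1 (fun g => g _) (partial_yshift b f s).
apply/funext => z; apply: complex_eqP => /=; exact: pe.
Qed.

Lemma cpartial_conj_fun b u : smooth (im u) ->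
  cpartial b (conj_fun u) = conj_fun (cpartial b u).
Proof.
move=> si; apply/funext => z; apply: complex_eqP => //=.
by rewrite /im/= -[RHS]/((fun z => - partial b (im u) z) z) -partialN.
Qed.

Lemma test_function_shift s u : `|s| <= 2 * pi -> test_function u ->
  test_function (shift_fun s u).
Proof.
move=> s2 [[sr si] /L20X_reim[Lr Li] [M uM]]; split.
- by split; [exact: (smooth_yshift s sr)|exact: (smooth_yshift s si)].
- by apply/L20X_reim; split; [exact: (real_L20_shift s2 Lr)
    |exact: (real_L20_shift s2 Li)].
- by exists M => x y; exact: uM.
Qed.

Lemma real_L20N f : real_L20 f -> real_L20 (fun z => - f z).
Proof.
move=> Lf; have := real_L20_lin (-1) 0 Lf Lf.
by congr real_L20; apply/funext => z; ring.
Qed.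

Lemma L20X_conj u : L20X u -> L20X (conj_fun u).
Proof. by move=> /L20X_reim[Lr Li]; apply/L20X_reim; split => //; exact: real_L20N. Qed.

Lemma test_function_conj u : test_function u -> test_function (conj_fun u).
Proof.
move=> [[sr si] Lu [M uM]]; split.
- by split; [exact: sr|exact: (smoothN si)].
- exact: L20X_conj.
- by exists M => x y /uM uxy; rewrite /conj_fun /re /im uxy /= oppr0.
Qed.

Lemma L20X_shift s u : `|s| <= 2 * pi -> L20X u -> L20X (shift_fun s u).
Proof.
by move=> s2 /L20X_reim[Lr Li]; apply/L20X_reim; split;
  [exact: (real_L20_shift s2 Lr)|exact: (real_L20_shift s2 Li)].
Qed.

Lemma ipNl f g : real_L2 f -> real_L2 g -> ip (fun z => - f z) g = - ip f g.
Proof.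
move=> Lf Lg; rewrite -mulN1r -ipZl//; apply: eq_Rintegral => z _.
by rewrite mulN1r.
Qed.

Lemma ip_yshift_adj s f g : `|s| <= 2 * pi -> real_L2 f -> real_L2 g ->
  ip (f \o yshift s) g = ip f (g \o yshift (- s)).
Proof.
move=> s2 Lf Lg; rewrite -[RHS](ip_shift s2)//; last by apply: real_L2_shift;
  rewrite ?normrN.
by apply: eq_Rintegral => z _ /=; rewrite yshiftK.
Qed.

Lemma operator_shift V P s u v : is_grushin_operator V P -> `|s| <= 2 * pi ->
  P (u, v) -> P (shift_fun s u, shift_fun s v).
Proof.
move=> gP s2; have s2' : `|- s| <= 2 * pi by rewrite normrN.
apply: (symmetry_of_operator (U' := shift_fun (- s)) (kappa := id) gP).
- exact: shift_funK.
- by have := shift_funK (- s); rewrite opprK.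
- exact: inj_id.
- by move=> w; exact: L20X_shift.
- by move=> w; exact: L20X_shift.
- move=> w1 w2 Lw1 Lw2; rewrite (L2dot_reim (L20X_shift s2 Lw1) Lw2)
    (L2dot_reim Lw1 (L20X_shift s2' Lw2)).
  move: Lw1 Lw2 => /L20X_reim[[r1 _] [i1 _]] /L20X_reim[[r2 _] [i2 _]].
  congr (_ +i* _); [congr (_ + _)|congr (_ - _)]; exact: ip_yshift_adj.
- by move=> w; exact: test_function_shift.
- by move=> w _; apply/funext => z; rewrite /grushin !cpartial_shift_fun.
Qed.

Lemma operator_conj V P u v : is_grushin_operator V P ->
  P (u, v) -> P (conj_fun u, conj_fun v).
Proof.
move=> gP.
apply: (symmetry_of_operator (U' := conj_fun) (kappa := fun z =>
  complex.Re z +i* (- complex.Im z)) gP).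
- exact: conj_funK.
- exact: conj_funK.
- by move=> [a1 b1] [a2 b2] [-> /oppr_inj ->].
- exact: L20X_conj.
- exact: L20X_conj.
- move=> w1 w2 Lw1 Lw2; rewrite (L2dot_reim (L20X_conj Lw1) Lw2)
    (L2dot_reim Lw1 (L20X_conj Lw2)).
  move: Lw1 Lw2 => /L20X_reim[[r1 _] [i1 _]] /L20X_reim[[r2 _] [i2 _]].
  have E1 : ip (im (conj_fun w1)) (im w2) = - ip (im w1) (im w2) by exact: ipNl.
  have E2 : ip (im (conj_fun w1)) (re w2) = - ip (im w1) (re w2) by exact: ipNl.
  have E3 : ip (im w1) (im (conj_fun w2)) = - ip (im w1) (im w2).
    by rewrite ipC ipNl// ipC.
  have E4 : ip (re w1) (im (conj_fun w2)) = - ip (re w1) (im w2).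
    by rewrite ipC ipNl// ipC.
  by rewrite E1 E2 E3 E4 /=; congr (_ +i* _); rewrite opprB addrC.
- exact: test_function_conj.
- move=> w [[sr si] _ _]; apply/funext => z; rewrite /grushin.
  have E b : cpartial b (cpartial b (conj_fun w)) = conj_fun (cpartial b (cpartial b w)).
    by rewrite (cpartial_conj_fun b si); apply: cpartial_conj_fun;
      exact: smooth_partial si.
  rewrite !E; move: (cpartial _ _) (cpartial _ _) => A B.
  rewrite /conj_fun /re /im; case: (A z) (B z) => [a b] [c d].
  by apply: complex_eqP => /=; ring.
Qed.

End Symmetries.

(** * Real eigenfunctions *)

Section RealEigen.
Local Open Scope complex_scope.
Variable R : realType.
Variables (V : R -> R) (P : operator R) (E : R).
Hypothesis gP : is_grushin_operator V P.
Implicit Types (u v : R * R -> R[i]) (f g h : R * R -> R) (k s : R).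

(** The equation [P f = E f] tested against the graph of [P], which is equivalent
    to it as [P] is its own adjoint.  In this weak form the real and imaginary
    parts of the test pair separate, and averages of solutions are solutions by
    exchanging two integrals. *)
Definition real_eigen f := real_L20 f /\ forall psi chi, P (psi, chi) ->
  ip f (re chi) = E * ip f (re psi) /\ ip f (im chi) = E * ip f (im psi).

Lemma operator_adjointE : P = adjoint P. Proof. by case: gP => -[]. Qed.

Lemma operator_L20X u v : P (u, v) -> L20X u /\ L20X v.
Proof. by rewrite operator_adjointE => -[]. Qed.

Lemma real_L20_re u : L20X u -> real_L20 (re u). Proof. by case/L20X_reim. Qed.
Lemma real_L20_im u : L20X u -> real_L20 (im u). Proof. by case/L20X_reim. Qed.

(** The weak equation for a pair of the graph mixes the two parts of [phi]; adding
    and subtracting the one for the conjugate pair separates them. *)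
Lemma op_eigenspace_parts phi : op_eigenspace P E phi ->
  real_eigen (re phi) /\ real_eigen (im phi).
Proof.
move=> Pphi; have [Lphi LEphi] := operator_L20X Pphi.
have [Lr _] := real_L20_re Lphi; have [Li _] := real_L20_im Lphi.
have key psi chi : P (psi, chi) ->
    ip (re phi) (re chi) + ip (im phi) (im chi) =
      E * (ip (re phi) (re psi) + ip (im phi) (im psi)) /\
    ip (im phi) (re chi) - ip (re phi) (im chi) =
      E * (ip (im phi) (re psi) - ip (re phi) (im psi)).
  move=> Ppsi; have [Lpsi Lchi] := operator_L20X Ppsi.
  have [Lpr _] := real_L20_re Lpsi; have [Lpi _] := real_L20_im Lpsi.
  have Er : re (fun z => E%:C * phi z) = (fun z => E * re phi z).
    by apply/funext => z; rewrite /re; case: (phi z) => a b /=; ring.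
  have Ei : im (fun z => E%:C * phi z) = (fun z => E * im phi z).
    by apply/funext => z; rewrite /im; case: (phi z) => a b /=; ring.
  have : L2dot phi chi = L2dot (fun z => E%:C * phi z) psi.
    by move: Pphi; rewrite /op_eigenspace/= operator_adjointE => -[_ _]; exact.
  rewrite (L2dot_reim Lphi Lchi) (L2dot_reim LEphi Lpsi) Er Ei !ipZl//.
  by move=> [-> ->]; split; ring.
suff H psi chi : P (psi, chi) ->
   [/\ ip (re phi) (re chi) = E * ip (re phi) (re psi),
       ip (re phi) (im chi) = E * ip (re phi) (im psi),
       ip (im phi) (re chi) = E * ip (im phi) (re psi) &
       ip (im phi) (im chi) = E * ip (im phi) (im psi)].
  split; split; [exact: real_L20_re| |exact: real_L20_im|];
    by move=> psi chi /H[].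
move=> Ppsi; have [Lpsi Lchi] := operator_L20X Ppsi.
have [k1 k2] := key _ _ Ppsi; have [k3 k4] := key _ _ (operator_conj gP Ppsi).
have cr w : re (conj_fun w) = re w by [].
have ci w f : L20X w -> real_L2 f -> ip f (im (conj_fun w)) = - ip f (im w).
  move=> Lw Lf; have [Lwi _] := real_L20_im Lw.
  by rewrite ipC -[im (conj_fun w)]/(fun z => - im w z) ipNl// ipC.
rewrite !cr !ci// in k3 k4.
by split; lra.
Qed.

Lemma real_eigen_op f : real_eigen f -> op_eigenspace P E (fun z => (f z)%:C).
Proof.
move=> [Lf Hf]; have L0 : real_L20 (fun _ : R * R => (0 : R)).
  by have := real_L20_lin 0 0 Lf Lf; congr real_L20; apply/funext => z; ring.
have Lu : L20X (fun z => (f z)%:C) by apply/L20X_reim.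
have LEu : L20X (fun z => E%:C * (f z)%:C).
  apply/L20X_reim; split.
    have := real_L20_lin E 0 Lf Lf; congr real_L20; apply/funext => z.
    by rewrite /re/=; ring.
  by move: L0; congr real_L20; apply/funext => z; rewrite /im/=; ring.
rewrite /op_eigenspace/= operator_adjointE; split => //= psi chi Ppsi.
have [Lpsi Lchi] := operator_L20X Ppsi.
have [Lpr _] := real_L20_re Lpsi; have [Lpi _] := real_L20_im Lpsi.
have [Lcr _] := real_L20_re Lchi; have [Lci _] := real_L20_im Lchi.
have [h1 h2] := Hf _ _ Ppsi; have [Lf2 _] := Lf.
rewrite (L2dot_reim Lu Lchi) (L2dot_reim LEu Lpsi).
have -> : re (fun z => E%:C * (f z)%:C) = (fun z => E * f z).
  by apply/funext => z; rewrite /re/=; ring.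
have -> : im (fun z => E%:C * (f z)%:C) = (fun z => 0 * f z).
  by apply/funext => z; rewrite /im/=; ring.
have -> : im (fun z => (f z)%:C) = (fun z => 0 * f z).
  by apply/funext => z; rewrite /im/= mul0r.
rewrite -[re (fun z => (f z)%:C)]/f !ipZl// h1 h2.
by congr (_ +i* _); ring.
Qed.

Lemma real_eigen_shift s f : `|s| <= 2 * pi -> real_eigen f ->
  real_eigen (f \o yshift s).
Proof.
move=> s2 [Lf Hf]; split; first exact: real_L20_shift.
move=> psi chi Ppsi; have [Lpsi Lchi] := operator_L20X Ppsi.
have [Lpr _] := real_L20_re Lpsi; have [Lpi _] := real_L20_im Lpsi.
have [Lcr _] := real_L20_re Lchi; have [Lci _] := real_L20_im Lchi.
have s2' : `|- s| <= 2 * pi by rewrite normrN.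
have [Lf2 _] := Lf; rewrite !ip_yshift_adj//.
exact: Hf (operator_shift gP s2' Ppsi).
Qed.
End RealEigen.

(** * Fourier modes *)

Section Modes.
Variable R : realType.
Local Notation lam := (@lebesgue_measure R).
Local Notation plane := (measurableTypeR R * measurableTypeR R)%type.
Local Notation circle := (`[- pi, pi]%classic : set (measurableTypeR R)).
Implicit Types (f g h r : R * R -> R) (k s phi x y : R) (n : nat).
#[local] Hint Resolve measurable_circle : core.

Definition cos_coef f n x := \int[lam]_(t in circle) (f (x, t) * cos (n%:R * t)).
Definition sin_coef f n x := \int[lam]_(t in circle) (f (x, t) * sin (n%:R * t)).

(** The value at [(x, y)] is the integral over [t] of
    [f (x, t) cos (n (t - y) + phi)], which is an average of translates of [f]; see
    [average_eq_mode]. *)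
Definition mode f n phi (z : R * R) : R :=
  cos_coef f n z.1 * cos (phi - n%:R * z.2) - sin_coef f n z.1 * sin (phi - n%:R * z.2).

Lemma cos_natmulD2pi n phi y : cos (n%:R * (y + 2 * pi) + phi) = cos (n%:R * y + phi).
Proof.
elim: n phi => [|n IHn] phi; first by rewrite !mul0r.
have -> : n.+1%:R * (y + 2 * pi) + phi = n%:R * (y + 2 * pi) + (y + phi) + pi *+ 2.
  by rewrite -natr1 -mulr_natl; ring.
by rewrite cosD2pi IHn -natr1; congr cos; ring.
Qed.

Lemma sin_eq_cos y : sin y = cos (y + - (pi / 2)).
Proof. by rewrite cosBpihalf. Qed.

Lemma sin_natmulD2pi n phi y : sin (n%:R * (y + 2 * pi) + phi) = sin (n%:R * y + phi).
Proof. by rewrite !sin_eq_cos -!addrA cos_natmulD2pi. Qed.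

Lemma measurable_sin_affine k phi :
  measurable_fun [set: measurableTypeR R] (fun y : R => sin (k * y + phi)).
Proof.
under eq_fun do rewrite sin_eq_cos -addrA.
exact: measurable_cos_affine.
Qed.

Lemma measurable_cos_mul n :
  measurable_fun [set: measurableTypeR R] (fun y : R => cos (n%:R * y)).
Proof.
by have := measurable_cos_affine n%:R (0 : R); under eq_fun do rewrite addr0.
Qed.

Lemma measurable_sin_mul n :
  measurable_fun [set: measurableTypeR R] (fun y : R => sin (n%:R * y)).
Proof.
by have := measurable_sin_affine n%:R (0 : R); under eq_fun do rewrite addr0.
Qed.

(** Shifting by half a period [pi / n] changes the sign of the integrand. *)
Lemma Rintegral_trig0 n a b : (0 < n)%N ->
  \int[lam]_(y in circle) (a * cos (n%:R * y) + b * sin (n%:R * y)) = 0.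
Proof.
move=> n0; have n0R : 0 < n%:R :> R by rewrite ltr0n.
pose g y := a * cos (n%:R * y) + b * sin (n%:R * y).
have mg : measurable_fun [set: measurableTypeR R] g.
  apply: measurable_funD; apply: measurable_funM; try exact: measurable_cst.
    exact: measurable_cos_mul.
  exact: measurable_sin_mul.
have gi : lam.-integrable circle (EFin \o g).
  have mcirc := @measurable_circle R.
  have mcos := measurable_funTS (D := circle) (measurable_cos_mul n).
  have msin := measurable_funTS (D := circle) (measurable_sin_mul n).
  apply: integrable_add => //.
    exact: (integrable_mul_le1 mcirc mcos (fun y => cos_max _) (integrable_circle_cst a)).
  exact: (integrable_mul_le1 mcirc msin (fun y => sin_max _) (integrable_circle_cst b)).
have := @Rintegral_circle_shift R (pi / n%:R) g _ mg _.
have -> : (fun y => g (y + pi / n%:R)) = (fun y => - 1 * g y).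
  apply/funext => y; rewrite /g mulrDr (mulrCA n%:R) divff ?gt_eqF// mulr1.
  by rewrite cosDpi sinDpi; ring.
rewrite RintegralZl// => h.
suff : - 1 * \int[lam]_(y in circle) g y = \int[lam]_(y in circle) g y by rewrite /g; lra.
apply: h.
  rewrite ger0_norm; last by rewrite divr_ge0// ?pi_ge0.
  rewrite ler_pdivrMr// -mulrA mulrCA ler_peMr ?pi_ge0//.
  by have n1 : 1 <= n%:R :> R; [rewrite ler1n|lra].
move=> y; rewrite /g; have := cos_natmulD2pi n 0 y; have := sin_natmulD2pi n 0 y.
by rewrite !addr0 => -> ->.
Qed.

Lemma measurable_Rintegral_slice h (D : set (measurableTypeR R)) : measurable D ->
  measurable_fun [set: plane] h ->
  measurable_fun [set: measurableTypeR R] (fun x => \int[lam]_(y in D) h (x, y)).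
Proof.
move=> mD mh; rewrite /Rintegral.
apply: (measurableT_comp (fine_measurable measurableT)) => /=.
have mhE : measurable_fun [set: plane] (EFin \o h) by exact/measurable_EFinP.
under eq_fun do rewrite integralE.
apply: emeasurable_funB.
  have := measurable_integral_slice mD (measurable_funepos mhE) (fun z =>
    funepos_ge0 _ _).
  apply: eq_measurable_fun => x _; apply: eq_integral => y _; by rewrite !funeposE.
have := measurable_integral_slice mD (measurable_funeneg mhE) (fun z => funeneg_ge0 _ _).
apply: eq_measurable_fun => x _; apply: eq_integral => y _; by rewrite !funenegE.
Qed.

Lemma measurable_cos_snd n phi : measurable_fun [set: plane]
  (fun z : plane => cos (n%:R * (z.2 : R) + phi)).
Proof. exact: (measurableT_comp (measurable_cos_affine n%:R phi)
  (@measurable_snd _ _ _ _)). Qed.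
End Modes.

Section ModesL2.
Variable R : realType.
Local Notation lam := (@lebesgue_measure R).
Local Notation plane := (measurableTypeR R * measurableTypeR R)%type.
Local Notation circle := (`[- pi, pi]%classic : set (measurableTypeR R)).
Implicit Types (f g h r : R * R -> R) (k s phi x y : R) (n : nat).
#[local] Hint Resolve measurable_circle : core.

(** The variance of [g c] is nonnegative and [c ^+ 2 <= 1]. *)
Lemma sqr_Rintegral_le (g c : R -> R) :
  measurable_fun [set: measurableTypeR R] g ->
    measurable_fun [set: measurableTypeR R] c ->
  (forall y, `|c y| <= 1) ->
  (((\int[lam]_(y in circle) (g y * c y))%R ^+ 2)%:E <=
   (2 * pi)%:E * \int[lam]_(y in circle) (g y ^+ 2)%:E)%E.
Proof.
move=> mg mc c1; have pi0 := @pi_gt0 R.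
have S0 : (0 <= \int[lam]_(y in circle) (g y ^+ 2)%:E)%E.
  by apply: integral_ge0 => y _; rewrite lee_fin sqr_ge0.
have [Soo|Sfin] := eqVneq (\int[lam]_(y in circle) (g y ^+ 2)%:E)%E +oo%E.
  by rewrite Soo gt0_muley ?leey// lte_fin mulr_gt0.
have Slty : (\int[lam]_(y in circle) (g y ^+ 2)%:E < +oo)%E by rewrite ltey.
pose h y := g y * c y.
have mh : measurable_fun [set: measurableTypeR R] h by exact: measurable_funM.
have hg y : h y ^+ 2 <= g y ^+ 2.
  rewrite /h exprMn -[leRHS]mulr1 ler_wpM2l ?sqr_ge0//.
  by rewrite -(real_normK (num_real _)) exprn_ile1.
have g2i : lam.-integrable circle (EFin \o (fun y => g y ^+ 2)).
  apply/integrableP; split.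
    by apply/measurable_EFinP; apply: measurable_funTS; exact: measurable_funX.
  by under eq_integral do rewrite /= ger0_norm ?sqr_ge0//.
have h2i : lam.-integrable circle (EFin \o (fun y => h y ^+ 2)).
  have g2i' := g2i; apply: le_integrable g2i' => //.
    by apply/measurable_EFinP; apply: measurable_funTS; exact: measurable_funX.
  by move=> y _ /=; rewrite lee_fin !ger0_norm ?sqr_ge0.
have hi : lam.-integrable circle (EFin \o h).
  apply: sqr_lty_integrable => //; move/integrableP : h2i => [_].
  by under eq_integral do rewrite /= ger0_norm ?sqr_ge0//.
set I := \int[lam]_(y in circle) h y; pose m := I / (2 * pi).
have var : 0 <= \int[lam]_(y in circle) (h y ^+ 2 + ((- (2 * m)) * h y + m ^+ 2)).
  apply: Rintegral_ge0 => y _.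
  by rewrite (_ : _ + _ = (h y - m) ^+ 2) ?sqr_ge0//; ring.
rewrite RintegralD// in var; last first.
  by apply: integrable_add => //; [exact: integrable_scale|exact: integrable_circle_cst].
rewrite RintegralD// in var; [|exact: integrable_scale|exact: integrable_circle_cst].
rewrite RintegralZl// -/I Rintegral_cst// in var.
rewrite -[fine _]/(fine (lam circle)) lebesgue_measure_circle /= in var.
have le2 : \int[lam]_(y in circle) (h y ^+ 2) <= \int[lam]_(y in circle) (g y ^+ 2).
  by apply: le_Rintegral.
rewrite -[X in (_ <= _ * X)%E]fineK; last by rewrite ge0_fin_numE.
rewrite -EFinM lee_fin -[fine _]/(\int[lam]_(y in circle) (g y ^+ 2)).
have Im : I = m * (2 * pi) by rewrite /m divfK// mulf_neq0// gt_eqF.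
rewrite Im in var *.
have : 0 <= \int[lam]_(y in circle) (g y ^+ 2) - m ^+ 2 * (2 * pi).
  by apply: (le_trans var); rewrite -subr_ge0; move: le2; rewrite -subr_ge0; lra.
move=> H; rewrite -subr_ge0.
rewrite [leRHS](_ : _ = 2 * pi * (\int[lam]_(y in circle) (g y ^+ 2)
  - m ^+ 2 * (2 * pi))); last ring.
by rewrite mulr_ge0// mulr_ge0// ltW.
Qed.

Lemma real_L2_coef f (c : R -> R) : real_L2 f ->
  measurable_fun [set: measurableTypeR R] c -> (forall y, `|c y| <= 1) ->
  real_L2 (fun z => \int[lam]_(t in circle) (f (z.1, t) * c t)).
Proof.
move=> [fp mf fi] mc c1.
have mfc : measurable_fun [set: plane] (fun z : plane => f z * c (z.2 : R)).
  apply: measurable_funM => //; exact: measurableT_comp mc (@measurable_snd _ _ _ _).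
have mA := measurable_Rintegral_slice (@measurable_circle R) mfc.
set A := (fun x => _) in mA.
have mA2 : measurable_fun [set: plane] (fun z : plane => A z.1).
  exact: measurableT_comp mA (@measurable_fst _ _ _ _).
split=> //.
have mf2 : measurable_fun [set: plane] (fun z => (f z ^+ 2)%:E).
  by apply/measurable_EFinP; exact: measurable_funX.
have f20 z : (0 <= (f z ^+ 2)%:E)%E by rewrite lee_fin sqr_ge0.
have mA3 : measurable_fun [set: plane] (fun z : plane => (A z.1 ^+ 2)%:E).
  by apply/measurable_EFinP; exact: measurable_funX.
have pi0 := @pi_gt0 R.
rewrite -[X in (X < _)%E]/(\int[area]_(z in cylinder) ((A z.1) ^+ 2)%:E)%E.
rewrite (integral_strip_sqr (@measurable_circle R) mA2).
rewrite (integral_strip_sqr (@measurable_circle R) mf) in fi.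
have mS := measurable_integral_slice (@measurable_circle R) mf2 f20.
apply: (@le_lt_trans _ _ (\int[lam]_x (((2 * pi) ^+ 2)%:E * \int[lam]_(y in circle)
  (f (x, y) ^+ 2)%:E)))%E.
  apply: ge0_le_integral => //.
  - by move=> x _; apply: integral_ge0 => y _; rewrite lee_fin sqr_ge0.
  - have := measurable_integral_slice (@measurable_circle R) mA3; apply.
    by move=> z; rewrite lee_fin sqr_ge0.
  - by apply: emeasurable_funM => //; exact: measurable_cst.
  move=> x _ /=; rewrite integral_cst// -[X in (_ * X <= _)%E]/(lam circle)
    lebesgue_measure_circle.
  rewrite (expr2 (2 * pi)) (EFinM (2 * pi)) -[leRHS]muleA [leLHS]muleC;
    apply: lee_wpmul2l; first by rewrite lee_fin ltW// mulr_gt0.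
  by apply: sqr_Rintegral_le => //; exact: measurable_slice.
rewrite ge0_integralZl//.
- by rewrite lte_mul_pinfty// lee_fin sqr_ge0.
- by move=> x _; apply: integral_ge0.
- by rewrite lee_fin sqr_ge0.
Qed.

Lemma real_L2_mul_le1 f g : real_L2 f -> measurable_fun [set: plane] g ->
  yperiodic g -> (forall z, `|g z| <= 1) -> real_L2 (fun z => f z * g z).
Proof.
move=> [fp mf fi] mg gp g1; split.
- by move=> x y; rewrite fp gp.
- exact: measurable_funM.
apply: le_lt_trans fi; apply: ge0_le_integral_cylinder.
- by apply: measurable_funX; exact: measurable_funM.
- exact: measurable_funX.
move=> z; rewrite sqr_ge0/= exprMn -[leRHS]mulr1 ler_wpM2l ?sqr_ge0//.
by rewrite -(real_normK (num_real _)) exprn_ile1.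
Qed.

Lemma modeE f n phi z : mode f n phi z =
  (cos_coef f n z.1 * cos phi - sin_coef f n z.1 * sin phi) * cos (n%:R * z.2) +
  (cos_coef f n z.1 * sin phi + sin_coef f n z.1 * cos phi) * sin (n%:R * z.2).
Proof. by rewrite /mode cosB sinB; ring. Qed.

Lemma real_L20_mode f n phi : (0 < n)%N -> real_L2 f -> real_L20 (mode f n phi).
Proof.
move=> n0 Lf.
have LA : real_L2 (fun z => cos_coef f n z.1).
  apply: real_L2_coef => //; [exact: measurable_cos_mul|move=> y; exact: cos_max].
have LB : real_L2 (fun z => sin_coef f n z.1).
  apply: real_L2_coef => //; [exact: measurable_sin_mul|move=> y; exact: sin_max].
have Lc : real_L2 (fun z => cos_coef f n z.1 * cos (phi - n%:R * z.2)).
  apply: real_L2_mul_le1 => //.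
  - have := measurable_cos_snd n (- phi).
    apply: eq_measurable_fun => z _; rewrite -cosN; congr cos; ring.
  - move=> x y /=; have := cos_natmulD2pi n (- phi) y.
    by rewrite -cosN -[X in _ = X -> _]cosN !opprD !opprK !(addrC _ phi).
  - by move=> z; exact: cos_max.
have Ls : real_L2 (fun z => sin_coef f n z.1 * sin (phi - n%:R * z.2)).
  apply: real_L2_mul_le1 => //.
  - have := measurable_cos_snd n (pi / 2 - phi).
    apply: eq_measurable_fun => z _; rewrite sin_eq_cos -cosN; congr cos; ring.
  - move=> x y /=; have := sin_natmulD2pi n (- phi) y => /(congr1 -%R).
    by rewrite -!sinN !opprD !opprK !(addrC _ phi).
  - by move=> z; exact: sin_max.
split.
  have := real_L2_lin 1 (-1) Lc Ls; congr real_L2; apply/funext => z.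
  by rewrite /mode; ring.
apply: aeW => x; under eq_Rintegral do rewrite modeE.
exact: (Rintegral_trig0 (cos_coef f n x * cos phi - sin_coef f n x * sin phi)
  (cos_coef f n x * sin phi + sin_coef f n x * cos phi) n0).
Qed.
End ModesL2.

(** * Fourier modes of eigenfunctions *)

Section Averaging.
Variable R : realType.
Local Notation lam := (@lebesgue_measure R).
Local Notation plane := (measurableTypeR R * measurableTypeR R)%type.
Local Notation circle := (`[- pi, pi]%classic : set (measurableTypeR R)).
Implicit Types (f g h r : R * R -> R) (k s phi x y : R) (n : nat).
#[local] Hint Resolve measurable_circle : core.

Lemma ae_fst (Q : R -> Prop) : {ae lam, forall x, Q x} -> {ae area, forall z, Q z.1}.
Proof.
move=> [N [mN N0 QN]]; exists (N `*` [set: measurableTypeR R]); split.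
- exact: measurableX.
- rewrite /area /= product_measure1E//;
    first by rewrite -[X in (X * _)%E]/(lam N) N0 mul0e.
- by move=> [x y] /= nQ; split => //; exact: QN.
Qed.

Lemma slice_shift_integrable f x y : real_L2 f -> `|y| <= 2 * pi ->
  (\int[lam]_(t in circle) (f (x, t) ^+ 2)%:E < +oo)%E ->
  lam.-integrable circle (EFin \o (fun s => f (x, s + y))).
Proof.
move=> [fp mf _] y2 fx.
have ms := measurable_slice x mf.
apply: sqr_lty_integrable; first exact: (measurableT_comp ms (measurable_shift y)).
rewrite (@ge0_integral_periodic_shift R y (fun t => (f (x, t) ^+ 2)%:E))//.
- by apply/measurable_EFinP; exact: measurable_funX.
- by move=> t; rewrite lee_fin sqr_ge0.
- by move=> t; rewrite fp.
Qed.

Lemma average_eq_mode f n phi x y : real_L2 f -> `|y| <= 2 * pi ->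
  (\int[lam]_(t in circle) (f (x, t) ^+ 2)%:E < +oo)%E ->
  \int[lam]_(s in circle) (f (x, s + y) * cos (n%:R * s + phi)) = mode f n phi (x, y).
Proof.
move=> Lf y2 fx; have [fp mf _] := Lf; have ms := measurable_slice x mf.
pose h t := f (x, t) * cos (n%:R * t + (phi - n%:R * y)).
have mh : measurable_fun [set: measurableTypeR R] h.
  by apply: measurable_funM => //; exact: measurable_cos_affine.
have hp t : h (t + 2 * pi) = h t by rewrite /h fp cos_natmulD2pi.
transitivity (\int[lam]_(s in circle) h (s + y)).
  apply: eq_Rintegral => s _; rewrite /h; congr (_ * cos _); ring.
rewrite (Rintegral_circle_shift y2 mh hp).
have fi : lam.-integrable circle (EFin \o (fun t => f (x, t))).
  exact: sqr_lty_integrable.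
pose a := cos (phi - n%:R * y); pose b := - sin (phi - n%:R * y).
have -> : h = (fun t => a * (f (x, t) * cos (n%:R * t)) + b * (f (x, t)
  * sin (n%:R * t))).
  by apply/funext => t; rewrite /h cosD /a /b; ring.
have ci : lam.-integrable circle (EFin \o (fun t => f (x, t) * cos (n%:R * t))).
  apply: integrable_mul_le1 => //; last by move=> t; exact: cos_max.
  by apply: measurable_funTS; exact: measurable_cos_mul.
have si : lam.-integrable circle (EFin \o (fun t => f (x, t) * sin (n%:R * t))).
  apply: integrable_mul_le1 => //; last by move=> t; exact: sin_max.
  by apply: measurable_funTS; exact: measurable_sin_mul.
rewrite RintegralD//; [|exact: integrable_scale..].
by rewrite !RintegralZl// /mode /cos_coef /sin_coef /a /b /=; ring.
Qed.

(** The mode is an average of the translates [f \o yshift s], so its scalar product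
    with [r] is the same average of zeros.  The exchange of the two integrals is
    Fubini's theorem for [F] on the product of the line and the plane; indicators
    turn the domains of integration into factors of [F]. *)
Lemma ip_mode f r n phi : (0 < n)%N -> real_L2 f -> real_L2 r ->
  (forall s, `|s| <= pi -> ip (f \o yshift s) r = 0) -> ip (mode f n phi) r = 0.
Proof.
move=> n0 Lf Lr fr0; have [fp mf fi] := Lf; have [rp mr ri] := Lr.
have pi0 := @pi_gt0 R.
have mcyl := @measurable_cylinder R.
have [[mp mm _] _] := real_L20_mode phi n0 Lf.
pose c (s : R) : R := \1_circle s * cos (n%:R * s + phi).
pose r1 (z : plane) : R := r z * \1_(cylinder : set plane) z.
pose F (w : measurableTypeR R * plane) : \bar R := (c w.1 * (f (yshift w.1 w.2)
  * r1 w.2))%:E.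
have mc : measurable_fun [set: measurableTypeR R] c.
  by apply: measurable_funM; [exact: measurable_indic|exact: measurable_cos_affine].
have mr1 : measurable_fun [set: plane] r1.
  by apply: measurable_funM => //; exact: measurable_indic.
have msh : measurable_fun [set: measurableTypeR R * plane]
    (fun w => yshift w.1 w.2 : plane).
  apply: (measurable_fun_pair
     (f := fun w : measurableTypeR R * plane => (w.2.1 : measurableTypeR R))).
    exact: (measurableT_comp (@measurable_fst _ _ _ _) (@measurable_snd _ _ _ _)).
  rewrite -[measurable_fun _ _]/(measurable_fun [set: measurableTypeR R * plane]
    (fun w : measurableTypeR R * plane => ((w.2.2 : R) + (w.1 : R))%R)).
  apply: measurable_funD.
    exact: (measurableT_comp (@measurable_snd _ _ _ _) (@measurable_snd _ _ _ _)).
  exact: measurable_fst.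
have mF : measurable_fun [set: measurableTypeR R * plane] F.
  apply/measurable_EFinP; apply: measurable_funM.
    exact: (measurableT_comp mc (@measurable_fst _ _ _ _)).
  apply: measurable_funM; first exact: measurableT_comp mf msh.
  exact: (measurableT_comp mr1 (@measurable_snd _ _ _ _)).
have s2pi s : `|s| <= pi -> `|s| <= 2 * pi by move=> s1; lra.
have circleP s : circle s -> `|s| <= pi by rewrite /= in_itv/= ler_norml.
pose K : \bar R := (\int[area]_(z in cylinder)
  (f z ^+ 2)%:E + \int[area]_(z in cylinder) (r z ^+ 2)%:E)%E.
have Kfin : (K < +oo)%E by apply: lte_add_pinfty.
have Kpos : (0 <= K)%E.
  by apply: adde_ge0; apply: integral_ge0 => z _; rewrite lee_fin sqr_ge0.
have Kfn : K \is a fin_num by rewrite ge0_fin_numE.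
have c1 s : `|c s| <= \1_circle s.
  rewrite /c normrM ger0_norm; last by rewrite indicE.
  by rewrite -[leRHS]mulr1 ler_wpM2l ?cos_max// indicE.
(* Uniformly in s, the scalar product is at most |f|^2 + |r|^2. *)
have bound s : (\int[area]_z `|F (s, z)| <= (fine K * \1_circle s)%:E)%E.
  have [cs|ncs] := pselect (circle s); last first.
    have c0 : c s = 0 by rewrite /c indicE memNset// mul0r.
    rewrite (eq_integral (cst 0%E)) ?integral0 ?lee_fin ?mulr_ge0 ?fine_ge0 ?indicE//.
    by move=> z _; rewrite /F /= c0 mul0r normr0.
  rewrite indicE mem_set// mulr1 fineK//.
  have LfS := real_L2_shift (s2pi _ (circleP _ cs)) Lf; have [_ mfS fiS] := LfS.
  apply: (@le_trans _ _ (\int[area]_z (((f \o yshift s) z ^+ 2 + r z ^+ 2)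
    * \1_(cylinder : set plane) z)%:E))%E.
    apply: ge0_le_integral => //.
    - apply: measurableT_comp => //; exact: measurableT_comp mF (measurable_pair1 _).
    - apply/measurable_EFinP; apply: measurable_funM; last exact: measurable_indic.
      by apply: measurable_funD; exact: measurable_funX.
    move=> z _; rewrite /F /= lee_fin /r1 normrM (normrM (f _)) (normrM (r z)).
    rewrite (ger0_norm (x := \1_cylinder z)) ?indicE//.
    have cs1 : `|c s| <= 1 by rewrite (le_trans (c1 s))// indicE lern1 leq_b1.
    rewrite !mulrA ler_wpM2r//.
    rewrite -(real_normK (num_real (f _))) -(real_normK (num_real (r z))).
    have := normr_ge0 (f (yshift s z)); have := normr_ge0 (r z); have := normr_ge0 (c s).
    move: cs1; move: `|f _| `|r z| `|c s| => p q t t1 t0 q0 p0.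
    have : 0 <= (p - q) ^+ 2 by exact: sqr_ge0.
    have pq0 : 0 <= p * q by rewrite mulr_ge0.
    have : t * (p * q) <= p * q by rewrite ler_piMl.
    nra.
  rewrite integral_indicM /K.
  have -> : (\int[area]_(z in cylinder) (f z ^+ 2)%:E = \int[area]_(z in cylinder)
    ((f \o yshift s) z ^+ 2)%:E)%E.
    rewrite (@ge0_integral_cylinder_shift R s (fun z => (f z ^+ 2)%:E))//.
    - exact/s2pi/circleP.
    - by apply/measurable_EFinP; exact: measurable_funX.
    - by move=> z; rewrite lee_fin sqr_ge0.
    - by move=> x y; rewrite fp.
  rewrite -ge0_integralD//.
  - by move=> z _; rewrite lee_fin sqr_ge0.
  - by apply/measurable_EFinP; apply: measurable_funTS; exact: measurable_funX.
  - by move=> z _; rewrite lee_fin sqr_ge0.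
  - by apply/measurable_EFinP; apply: measurable_funTS; exact: measurable_funX.
have Flty : (\int[lam]_s \int[(@plane_measure R)]_z `|F (s, z)| < +oo)%E.
  apply: (@le_lt_trans _ _ (\int[lam]_s (fine K * \1_circle s)%:E))%E.
    apply: ge0_le_integral => //.
    - by move=> s _; apply: integral_ge0.
    - have mabsF : measurable_fun [set: measurableTypeR R * plane] (abse \o F).
        exact: measurableT_comp.
      exact: (measurable_fun_fubini_tonelli_F (m2 := (@plane_measure R)) _ mabsF
        (fun w => abse_ge0 (F w))).
    - by apply/measurable_EFinP; apply: measurable_funM => //; exact: measurable_indic.
  rewrite (integral_indicM lam circle (fun=> fine K)) integral_cst//.
  by rewrite -[X in (_ * X < _)%E]/(lam circle) lebesgue_measure_circle -EFinM ltry.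
have Fint := (integrable12ltyP lam (@plane_measure R) mF).2 Flty.
(* Integrating in the plane first gives 0 for each s. *)
have := Fubini Fint.
rewrite (eq_integral (cst 0%E)); last first.
  move=> s _; rewrite /F /=.
  have [cs|ncs] := pselect (circle s); last first.
    by rewrite /c indicE memNset//; under eq_integral do rewrite mul0r mul0r;
      rewrite integral0.
  have LfS := real_L2_shift (s2pi _ (circleP _ cs)) Lf.
  have i1 := real_L2_integrable_mul LfS Lr.
  have -> : (fun z : plane => (c s * (f (yshift s z) * r1 z))%:E) =
      (fun z : plane => (c s * ((f \o yshift s) z * r z) * \1_(cylinder : set plane)
        z)%:E).
    by apply/funext => z; rewrite /r1 /= !mulrA.
  rewrite (integral_indicM area (cylinder : set plane) (fun z =>
    c s * ((f \o yshift s) z * r z))).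
  have i2 := integrable_scale mcyl (c s) i1.
  rewrite -[LHS]fineK; last exact: (integrable_fin_num mcyl i2).
  rewrite -[fine _]/(\int[area]_(z in cylinder) (c s * ((f \o yshift s) z * r z))).
  by rewrite RintegralZl// -/(ip _ _) fr0 ?mulr0//; exact: circleP.
rewrite integral0 => /esym G0.
(* Integrating in s first gives the mode times r, for almost every z. *)
have mG := measurable_fubini_G Fint.
have : {ae area, forall z : plane, setT z ->
  fubini_G lam F z = (mode f n phi z * r z * \1_(cylinder : set plane) z)%:E}.
  have := ae_fst (ae_slice_sqr_lty Lf).
  apply: (@filterS _ _ (@area_ae_filter R)) => -[x y] /= fx _.
  rewrite /fubini_G /F /r1 /yshift /=.
  have [cz|ncz] := pselect (cylinder (x, y)); last first.
    rewrite indicE memNset// !mulr0 (eq_integral (cst 0%E)) ?integral0//.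
    by move=> s _; rewrite !mulr0.
  rewrite indicE mem_set// !mulr1.
  have y2 : `|y| <= 2 * pi.
    by move: cz; rewrite /cylinder /strip/= in_itv/= -ler_norml => ?; lra.
  have fi1 := slice_shift_integrable Lf y2 fx.
  have fci := integrable_mul_cos n%:R phi (@measurable_circle R) fi1.
  have -> : (fun s => (c s * (f (x, y + s) * r (x, y)))%:E) =
     (fun s => (r (x, y) * (f (x, s + y) * cos (n%:R * s + phi)) * \1_circle s)%:E).
    by apply/funext => s; rewrite /c (addrC y); congr EFin; ring.
  rewrite (integral_indicM lam circle (fun s =>
    r (x, y) * (f (x, s + y) * cos (n%:R * s + phi)))).
  have i2 := integrable_scale (@measurable_circle R) (r (x, y)) fci.
  rewrite -[LHS]fineK; last exact: (integrable_fin_num (@measurable_circle R) i2).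
  rewrite -[fine _]/(\int[lam]_(s in circle) (r (x, y) * (f (x, s + y)
    * cos (n%:R * s + phi)))).
  by rewrite RintegralZl// average_eq_mode// mulrC.
move=> aeG; rewrite /ip /Rintegral -(integral_indicM area (cylinder : set plane)).
rewrite -[RHS]/(fine 0%E) -G0; congr fine; apply/esym.
apply: (@ae_eq_integral _ _ _ area setT) => //.
by apply/measurable_EFinP; apply: measurable_funM;
  [exact: measurable_funM|exact: measurable_indic].
Qed.
End Averaging.

Section Completeness.
Variable R : realType.
Local Notation lam := (@lebesgue_measure R).
Local Notation plane := (measurableTypeR R * measurableTypeR R)%type.
Local Notation circle := (`[- pi, pi]%classic : set (measurableTypeR R)).
Implicit Types (f g h r : R * R -> R) (k s phi x y : R) (n : nat).
#[local] Hint Resolve measurable_circle : core.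

Lemma ip_linear_r f g h k1 k2 : real_L2 f -> real_L2 g -> real_L2 h ->
  ip f (fun z => k1 * g z + k2 * h z) = k1 * ip f g + k2 * ip f h.
Proof.
move=> Lf Lg Lh.
have sc k (w : R * R -> R) : real_L2 w -> real_L2 (fun z => k * w z).
  move=> Lw; have := real_L2_lin k 0 Lw Lw.
  by congr real_L2; apply/funext => z; rewrite mul0r addr0.
by rewrite ipC ipDl//; [rewrite !ipZl// !(ipC f)|exact: sc|exact: sc].
Qed.

(** The weak equation at [(psi, chi)] says that [f] is orthogonal to
    [chi - E psi]; all translates of [f] satisfy it, hence so does their average. *)
Lemma real_eigen_mode (V : R -> R) (P : operator R) (E : R) f n phi :
  is_grushin_operator V P -> (0 < n)%N -> real_eigen P E f ->
  real_eigen P E (mode f n phi).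
Proof.
move=> gP n0 ef; have [[Lf _] _] := ef.
have Lm := real_L20_mode phi n0 Lf; split=> // psi chi Ppsi.
have [Lpsi Lchi] := operator_L20X gP Ppsi; have [Lm2 _] := Lm.
have [Lpr _] := real_L20_re Lpsi; have [Lpi _] := real_L20_im Lpsi.
have [Lcr _] := real_L20_re Lchi; have [Lci _] := real_L20_im Lchi.
have key p q : real_L2 p -> real_L2 q ->
    (forall s, `|s| <= pi -> ip (f \o yshift s) q = E * ip (f \o yshift s) p) ->
    ip (mode f n phi) q = E * ip (mode f n phi) p.
  move=> Lp Lq H; have Lr := real_L2_lin 1 (- E) Lq Lp.
  have : ip (mode f n phi) (fun z => 1 * q z + (- E) * p z) = 0.
    apply: ip_mode => // s s1.
    have Lfs : real_L2 (f \o yshift s).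
      by apply: real_L2_shift => //; have := @pi_gt0 R; lra.
    by rewrite ip_linear_r// H//; ring.
  by rewrite ip_linear_r// => ?; lra.
have sh s : `|s| <= pi -> real_eigen P E (f \o yshift s).
  by move=> s1; apply: (real_eigen_shift gP) => //; have := @pi_gt0 R; lra.
by split; apply: key => // s /sh[_ /(_ _ _ Ppsi)[]].
Qed.

(** On almost every circle all Fourier coefficients vanish, the one of frequency 0
    because the mean is zero. *)
Lemma real_L20_complete f : real_L20 f ->
  (forall n, (0 < n)%N -> {ae lam, forall x, cos_coef f n x = 0 /\ sin_coef f n x = 0}) ->
  {ae area, forall z, cylinder z -> f z = 0}.
Proof.
move=> [Lf f0] H; have [fp mf fi] := Lf.
have aeF := ae_filter_ringOfSetsType lam.
have H1 : {ae lam, forall x, forall n, (0 < n)%N ->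
  cos_coef f n x = 0 /\ sin_coef f n x = 0}.
  apply/ae_foralln => n; case: n => [|n]; first exact: aeW.
  by apply: (@filterS _ _ aeF _ _ _ (H n.+1 isT)) => x.
have H2 : {ae lam, forall x, (\int[lam]_(y in circle) (f (x, y) ^+ 2)%:E = 0)%E}.
  move: H1 f0 (ae_slice_integrable Lf); apply: (@filterS3 _ _ aeF) => x cs x0 ifx.
  have Z : fourier_null (fun y => f (x, y)).
    split=> // n phi.
    have ci : lam.-integrable circle (EFin \o (fun t => f (x, t) * cos (n%:R * t))).
      apply: integrable_mul_le1 => //; last by move=> t; exact: cos_max.
      by apply: measurable_funTS; exact: measurable_cos_mul.
    have si : lam.-integrable circle (EFin \o (fun t => f (x, t) * sin (n%:R * t))).
      apply: integrable_mul_le1 => //; last by move=> t; exact: sin_max.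
      by apply: measurable_funTS; exact: measurable_sin_mul.
    transitivity (cos phi * cos_coef f n x + - sin phi * sin_coef f n x).
      rewrite /cos_coef /sin_coef -!RintegralZl// -RintegralD//;
        [|exact: integrable_scale..].
      by apply: eq_Rintegral => t _; rewrite cosD; ring.
    case: n {ci si} => [|n]; last by have [-> ->] := cs n.+1 isT; rewrite !mulr0 addr0.
    rewrite /cos_coef /sin_coef.
    under eq_Rintegral do rewrite mul0r cos0 mulr1.
    rewrite x0; under eq_Rintegral do rewrite mul0r sin0 mulr0.
    by rewrite /Rintegral integral0 /= !mulr0 addr0.
  rewrite (@ae_eq_integral _ _ _ lam circle (cst 0%E)) ?integral0//.
    apply/measurable_EFinP; apply: measurable_funTS; apply: measurable_funX.
    exact: measurable_slice.
  apply: (@filterS _ _ aeF _ _ _ (fourier_null_ae0 Z)) => y fy cy.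
  by rewrite fy// expr0n.
apply/(ae_cylinder_eq0 mf).1.
rewrite (integral_strip_sqr (@measurable_circle R) mf).
rewrite (@ae_eq_integral _ _ _ lam setT (cst 0%E)) ?integral0//.
  apply: (@measurable_integral_slice R circle (fun z => (f z ^+ 2)%:E)) => //.
    by apply/measurable_EFinP; exact: measurable_funX.
  by move=> z; rewrite lee_fin sqr_ge0.
by apply: (@filterS _ _ aeF _ _ _ H2) => x ? _.
Qed.
End Completeness.

(** * Eigenspaces of dimension two *)

Section Concentration.
Local Open Scope complex_scope.
Variable R : realType.
Local Notation lam := (@lebesgue_measure R).
Local Notation plane := (measurableTypeR R * measurableTypeR R)%type.
Local Notation circle := (`[- pi, pi]%classic : set (measurableTypeR R)).
Implicit Types (f g h r : R * R -> R) (k s phi x y : R) (n : nat).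
#[local] Hint Resolve measurable_circle : core.

Definition wave (c d : R -> R) n (z : R * R) : R :=
  c z.1 * cos (n%:R * z.2) + d z.1 * sin (n%:R * z.2).

Lemma measurable_wave c d n : measurable_fun [set: measurableTypeR R] c ->
  measurable_fun [set: measurableTypeR R] d ->
  measurable_fun [set: plane] (wave c d n).
Proof.
move=> mc md; apply: measurable_funD; apply: measurable_funM.
- exact: (measurableT_comp mc (@measurable_fst _ _ _ _)).
- exact: (measurableT_comp (measurable_cos_mul n) (@measurable_snd _ _ _ _)).
- exact: (measurableT_comp md (@measurable_fst _ _ _ _)).
- exact: (measurableT_comp (measurable_sin_mul n) (@measurable_snd _ _ _ _)).
Qed.

Lemma wave_concentration c d n a b : (0 < n)%N -> a < b ->
  measurable_fun [set: measurableTypeR R] c ->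
  measurable_fun [set: measurableTypeR R] d ->
  (\int[area]_(z in cylinder) (wave c d n z ^+ 2)%:E <=
   (2 * pi / (b - a - `|sin (b - a)|))%:E *
   \int[area]_(z in strip `]a, b[) (wave c d n z ^+ 2)%:E)%E.
Proof.
move=> n0 ab mc md; set kappa := b - a - _.
have k0 : 0 < kappa by rewrite subr_gt0 norm_sin_lt// subr_gt0.
have C0 : 0 <= 2 * pi / kappa by rewrite divr_ge0 ?mulr_ge0 ?pi_ge0// ltW.
have mI : measurable (`]a, b[%classic : set (measurableTypeR R)) by exact: measurable_itv.
have mr := measurable_wave n mc md.
have mr2 : measurable_fun [set: plane] (fun z => (wave c d n z ^+ 2)%:E).
  by apply/measurable_EFinP; exact: measurable_funX.
have r20 z : (0 <= (wave c d n z ^+ 2)%:E)%E by rewrite lee_fin sqr_ge0.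
rewrite !integral_strip_sqr//.
have mS := measurable_integral_slice mI mr2 r20.
have mS1 := measurable_integral_slice (@measurable_circle R) mr2 r20.
rewrite -ge0_integralZl//; last by move=> x _; exact: integral_ge0.
apply: ge0_le_integral => //.
- by move=> x _; exact: integral_ge0.
- by apply: emeasurable_funM => //; exact: measurable_cst.
move=> x _; rewrite /wave/= integral_trig_sqr_circle//.
have := integral_trig_sqr_arc_ge (c x) (d x) n0 ab; rewrite -/kappa => h.
apply: (le_trans _ (lee_wpmul2l _ h)); last by rewrite lee_fin.
by rewrite -EFinM lee_fin le_eqVlt; apply/orP; left; apply/eqP; field; rewrite gt_eqF.
Qed.

(** The square integral of the wave over the circle at [x] is
    [pi (c x ^+ 2 + d x ^+ 2)]. *)
Lemma wave_ae0 c d n : (0 < n)%N ->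
  measurable_fun [set: measurableTypeR R] c ->
  measurable_fun [set: measurableTypeR R] d ->
  {ae area, forall z, cylinder z -> wave c d n z = 0} ->
  {ae lam, forall x, c x = 0 /\ d x = 0}.
Proof.
move=> n0 mc md; have mr := measurable_wave n mc md.
move/(ae_cylinder_eq0 mr).2; rewrite integral_strip_sqr//.
have pi0 := @pi_gt0 R.
have m2 : measurable_fun [set: measurableTypeR R] (fun x =>
  (pi * (c x ^+ 2 + d x ^+ 2))%:E).
  apply/measurable_EFinP; apply: measurable_funM; first exact: measurable_cst.
  by apply: measurable_funD; exact: measurable_funX.
have -> : (\int[lam]_x \int[lam]_(y in circle) (wave c d n (x, y) ^+ 2)%:E =
    \int[lam]_x (pi * (c x ^+ 2 + d x ^+ 2))%:E)%E.
  by apply: eq_integral => x _; rewrite /wave/= integral_trig_sqr_circle.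
have p0 x : 0 <= pi * (c x ^+ 2 + d x ^+ 2) by apply: mulr_ge0;
  [exact: ltW|apply: addr_ge0; exact: sqr_ge0].
move=> h; have := (ae_eq_integral_abs lam measurableT m2).1.
under eq_integral do rewrite gee0_abs ?lee_fin//.
move=> /(_ h); apply: (@filterS _ _ (ae_filter_ringOfSetsType lam)) => x /= /(_ I)[] /eqP.
rewrite mulf_eq0 (gt_eqF pi0)/= paddr_eq0 ?sqr_ge0// !sqrf_eq0.
by move=> /andP[/eqP -> /eqP ->].
Qed.

Lemma ae_cylinder_integral (I : set (measurableTypeR R)) f g : measurable I ->
  I `<=` circle -> measurable_fun [set: plane] f -> measurable_fun [set: plane] g ->
  {ae area, forall z, cylinder z -> f z = g z} ->
  (\int[area]_(z in strip I) (f z)%:E = \int[area]_(z in strip I) (g z)%:E)%E.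
Proof.
move=> mI Ic mf mg fg; apply: ae_eq_integral.
- exact: measurable_strip.
- by apply/measurable_EFinP; exact: measurable_funTS.
- by apply/measurable_EFinP; exact: measurable_funTS.
by apply: (@filterS _ _ (@area_ae_filter R) _ _ _ fg) => z fgz /Ic zc; rewrite fgz.
Qed.

(** The coordinates [(p, q)] and [(r, s)] of [u1] and [u2] in a basis have nonzero
    determinant: otherwise [s u1 - q u2] and [r u1 - p u2] vanish, so [p], [q],
    [r], [s] are all zero and independence fails.  Cramer's rule then gives the
    coefficients of [phi]. *)
Lemma two_dimensional_span (S : set (R * R -> R[i])) (u1 u2 phi : R * R -> R[i]) :
  has_dimension S 2 -> S u1 -> S u2 -> S phi ->
  (forall alpha beta, eqX (fun z => alpha * u1 z + beta * u2 z) (fun=> 0) ->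
     alpha = 0 /\ beta = 0) ->
  exists alpha beta, eqX phi (fun z => alpha * u1 z + beta * u2 z).
Proof.
move=> [e [_ _ span]] Su1 Su2 Sphi indep.
have sp u : S u -> exists a b, eqX u (fun z => a * e ord0 z + b * e (lift ord0 ord0) z).
  move=> /span[c uc]; exists (c ord0), (c (lift ord0 ord0)).
  apply: (@filterS _ _ (@area_ae_filter R) _ _ _ uc) => z h /h ->.
  by rewrite big_ord_recl big_ord1.
have [p [q E1]] := sp _ Su1; have [r [s E2]] := sp _ Su2; have [x [y E3]] := sp _ Sphi.
have lin a b : eqX (fun z => a * u1 z + b * u2 z)
    (fun z => (a * p + b * r) * e ord0 z + (a * q + b * s) * e (lift ord0 ord0) z).
  apply: (@filterS2 _ _ (@area_ae_filter R) _ _ _ _ E1 E2) => z h1 h2 cz.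
  by rewrite h1// h2//; ring.
have [det0|det0] := eqVneq (p * s - q * r) 0.
  have zero a b : a * p + b * r = 0 -> a * q + b * s = 0 -> a = 0 /\ b = 0.
    move=> h1 h2; apply: indep; apply: (@filterS _ _ (@area_ae_filter R)
      _ _ _ (lin a b)) => z h /h ->.
    by rewrite h1 h2 !mul0r addr0.
  have [s0 /eqP] : s = 0 /\ - q = 0.
    by apply: zero; [rewrite mulNr (mulrC s)|ring].
  rewrite oppr_eq0 => /eqP q0.
  have [r0 /eqP] : r = 0 /\ - p = 0.
    by apply: zero; [ring|rewrite mulNr (mulrC r) -opprB det0 oppr0].
  rewrite oppr_eq0 => /eqP p0.
  have [/eqP] : 1 = 0 :> R[i] /\ 0 = 0 :> R[i].
    by apply: zero; rewrite ?p0 ?q0 mulr0 mul0r addr0.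
  by rewrite oner_eq0.
pose A := (x * s - y * r) / (p * s - q * r).
pose B := (y * p - x * q) / (p * s - q * r).
exists A, B; apply: (@filterS2 _ _ (@area_ae_filter R) _ _ _ _ E3 (lin A B)) =>
  z h1 h2 cz.
by rewrite h1// h2// /A /B; field; exact: det0.
Qed.
End Concentration.

Section SingleFrequency.
Local Open Scope complex_scope.
Variable R : realType.
Local Notation lam := (@lebesgue_measure R).
Local Notation plane := (measurableTypeR R * measurableTypeR R)%type.
Local Notation circle := (`[- pi, pi]%classic : set (measurableTypeR R)).
Implicit Types (f g h r : R * R -> R) (k s x y : R) (n : nat).
#[local] Hint Resolve measurable_circle : core.

Lemma measurable_cos_coef f n : measurable_fun [set: plane] f ->
  measurable_fun [set: measurableTypeR R] (cos_coef f n).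
Proof.
move=> mf; apply: (@measurable_Rintegral_slice R (fun z => f z * cos (n%:R * z.2))) => //.
apply: measurable_funM => //.
exact: (measurableT_comp (measurable_cos_mul n) (@measurable_snd _ _ _ _)).
Qed.

Lemma measurable_sin_coef f n : measurable_fun [set: plane] f ->
  measurable_fun [set: measurableTypeR R] (sin_coef f n).
Proof.
move=> mf; apply: (@measurable_Rintegral_slice R (fun z => f z * sin (n%:R * z.2))) => //.
apply: measurable_funM => //.
exact: (measurableT_comp (measurable_sin_mul n) (@measurable_snd _ _ _ _)).
Qed.

(** The two phases [0] and [- pi / 2] give [A cos n y + B sin n y] and
    [B cos n y - A sin n y]. *)
Lemma mode_combination f n k s z :
  k * mode f n 0 z + s * mode f n (- (pi / 2)) z =
  wave (fun x => k * cos_coef f n x + s * sin_coef f n x)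
           (fun x => k * sin_coef f n x - s * cos_coef f n x) n z.
Proof.
by rewrite !modeE /wave cos0 sin0 cosN sinN cos_pihalf sin_pihalf; ring.
Qed.

Lemma measurable_lin (c d : R -> R) k s : measurable_fun [set: measurableTypeR R] c ->
  measurable_fun [set: measurableTypeR R] d ->
  measurable_fun [set: measurableTypeR R] (fun x => k * c x + s * d x).
Proof.
by move=> mc md; apply: measurable_funD; apply: measurable_funM => //;
  exact: measurable_cst.
Qed.

(** The combination is a wave with amplitudes [k A + s B] and [k B - s A]; the
    determinant of this system in [A] and [B] is [k^2 + s^2], so both
    can vanish with [(A, B)] nonzero only if [k = s = 0]. *)
Lemma modes_independent f n k s : (0 < n)%N -> measurable_fun [set: plane] f ->
  ~ {ae lam, forall x, cos_coef f n x = 0 /\ sin_coef f n x = 0} ->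
  {ae area, forall z, cylinder z ->
    k * mode f n 0 z + s * mode f n (- (pi / 2)) z = 0} ->
  k = 0 /\ s = 0.
Proof.
move=> n0 mf nz h.
have mA := measurable_cos_coef n mf; have mB := measurable_sin_coef n mf.
have mAB : measurable_fun [set: measurableTypeR R] (fun x =>
  k * sin_coef f n x - s * cos_coef f n x).
  by have := measurable_lin k (- s) mB mA; under eq_fun do rewrite mulNr.
have H : {ae lam, forall x, k * cos_coef f n x + s * sin_coef f n x = 0 /\
     k * sin_coef f n x - s * cos_coef f n x = 0}.
  apply: (wave_ae0 n0 (measurable_lin k s mA mB) mAB).
  by apply: (@filterS _ _ (@area_ae_filter R) _ _ _ h) => z hz /hz;
    rewrite mode_combination.
have [ks0|ks0] := eqVneq (k ^+ 2 + s ^+ 2) 0.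
  by move/eqP: ks0; rewrite paddr_eq0 ?sqr_ge0// !sqrf_eq0 => /andP[/eqP -> /eqP ->].
exfalso; apply: nz; apply: (@filterS _ _ (ae_filter_ringOfSetsType lam) _ _ _ H) => x.
move: (cos_coef _ _ _) (sin_coef _ _ _) => A B [h1 h2].
split; apply: (mulfI ks0); rewrite mulr0.
  transitivity (k * (k * A + s * B) - s * (k * B - s * A)); first ring.
  by rewrite h1 h2 !mulr0 subr0.
transitivity (s * (k * A + s * B) + k * (k * B - s * A)); first ring.
by rewrite h1 h2 !mulr0 addr0.
Qed.

Lemma exists_mode f : real_L20 f -> ~ {ae area, forall z, cylinder z -> f z = 0} ->
  exists2 n, (0 < n)%N & ~ {ae lam, forall x, cos_coef f n x = 0 /\ sin_coef f n x = 0}.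
Proof.
move=> Lf nf; apply: contrapT => H; apply: nf; apply: real_L20_complete => // n n0.
by apply: contrapT => nn; apply: H; exists n.
Qed.

(** A nonzero real eigenfunction has a nonzero mode of some frequency [n]; its two
    modes of phases [0] and [- pi / 2] are independent eigenfunctions, hence span
    the eigenspace. *)
Lemma eigenspace_single_frequency (V : R -> R) (P : operator R) (E : R) (phi : R * R ->
  R[i]) :
  is_grushin_operator V P -> has_dimension (op_eigenspace P E) 2 ->
  op_eigenspace P E phi -> ~ eqX phi (fun=> 0) ->
  exists n (c1 d1 c2 d2 : R -> R),
  [/\ (0 < n)%N,
      measurable_fun [set: measurableTypeR R] c1 /\
      measurable_fun [set: measurableTypeR R] d1,
      measurable_fun [set: measurableTypeR R] c2 /\
      measurable_fun [set: measurableTypeR R] d2 &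
      eqX phi (fun z => wave c1 d1 n z +i* wave c2 d2 n z)].
Proof.
move=> gP dim2 Sphi nphi; have [er ei] := op_eigenspace_parts gP Sphi.
have [f ef nf] : exists2 f, real_eigen P E f & ~ {ae area, forall z, cylinder z ->
  f z = 0}.
  apply: contrapT => H; apply: nphi.
  have zr : {ae area, forall z, cylinder z -> re phi z = 0}.
    by apply: contrapT => nr; apply: H; exists (re phi).
  have zi : {ae area, forall z, cylinder z -> im phi z = 0}.
    by apply: contrapT => nr; apply: H; exists (im phi).
  apply: (@filterS2 _ _ (@area_ae_filter R) _ _ _ _ zr zi) => z h1 h2 cz.
  by apply: complex_eqP; [exact: h1|exact: h2].
have [Lf _] := ef; have [[_ mf _] _] := Lf.
have [n n0 nz] := exists_mode Lf nf.
have S1 := real_eigen_op gP (real_eigen_mode 0 gP n0 ef).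
have S2 := real_eigen_op gP (real_eigen_mode (- (pi / 2)) gP n0 ef).
have comb (alpha beta : R[i]) z :
  alpha * (mode f n 0 z)%:C + beta * (mode f n (- (pi / 2)) z)%:C =
  (complex.Re alpha * mode f n 0 z + complex.Re beta * mode f n (- (pi / 2)) z) +i*
  (complex.Im alpha * mode f n 0 z + complex.Im beta * mode f n (- (pi / 2)) z).
  by case: alpha beta => [a1 a2] [b1 b2]; apply: complex_eqP => /=; ring.
have [|alpha [beta phiE]] := two_dimensional_span dim2 S1 S2 Sphi.
  move=> alpha beta h.
  have [h1 h2] : (complex.Re alpha = 0 /\ complex.Re beta = 0) /\
                 (complex.Im alpha = 0 /\ complex.Im beta = 0).
    split; apply: (modes_independent n0 mf nz);
      apply: (@filterS _ _ (@area_ae_filter R) _ _ _ h) => z hz /hz.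
      by rewrite comb => /(congr1 (@complex.Re R)).
    by rewrite comb => /(congr1 (@complex.Im R)).
  by split; apply: complex_eqP; rewrite /=; case: h1 h2 => ? ? [].
have mA := measurable_cos_coef n mf; have mB := measurable_sin_coef n mf.
have mC (k l : R) : measurable_fun [set: measurableTypeR R]
    (fun x => k * sin_coef f n x - l * cos_coef f n x).
  by have := measurable_lin k (- l) mB mA; under eq_fun do rewrite mulNr.
exists n, (fun x => complex.Re alpha * cos_coef f n x + complex.Re beta * sin_coef f n x),
  (fun x => complex.Re alpha * sin_coef f n x - complex.Re beta * cos_coef f n x),
  (fun x => complex.Im alpha * cos_coef f n x + complex.Im beta * sin_coef f n x),
  (fun x => complex.Im alpha * sin_coef f n x - complex.Im beta * cos_coef f n x).
split.
- exact: n0.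
- by split; [exact: measurable_lin|exact: mC].
- by split; [exact: measurable_lin|exact: mC].
apply: (@filterS _ _ (@area_ae_filter R) _ _ _ phiE) => z hz /hz ->.
by rewrite comb !mode_combination.
Qed.

Lemma sqmod_strip_split (I : set (measurableTypeR R)) (phi : R * R ->
  R[i]) (g1 g2 : R * R -> R) :
  measurable I -> I `<=` circle -> L2X phi ->
  measurable_fun [set: plane] g1 -> measurable_fun [set: plane] g2 ->
  eqX phi (fun z => g1 z +i* g2 z) ->
  (\int[area]_(z in strip I) (sqmod (phi z))%:E =
   \int[area]_(z in strip I) (g1 z ^+ 2)%:E + \int[area]_(z in strip I) (g2 z ^+ 2)%:E)%E.
Proof.
move=> mI Ic [_ mr mi _] m1 m2 phiE.
rewrite (@ae_cylinder_integral R I _ (fun z => g1 z ^+ 2 + g2 z ^+ 2))//.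
- rewrite -ge0_integralD//.
  + exact: measurable_strip.
  + by move=> z _; rewrite lee_fin sqr_ge0.
  + by apply/measurable_EFinP; apply: measurable_funTS; exact: measurable_funX.
  + by move=> z _; rewrite lee_fin sqr_ge0.
  + by apply/measurable_EFinP; apply: measurable_funTS; exact: measurable_funX.
- by apply: measurable_funD; exact: measurable_funX.
- by apply: measurable_funD; exact: measurable_funX.
- by apply: (@filterS _ _ (@area_ae_filter R) _ _ _ phiE) => z hz /hz ->.
Qed.

End SingleFrequency.

Theorem theorem2 (R : realType) (gamma : R) (V : R -> R) (P : operator R)
    (a b : R) :
  0 < gamma ->
  potential_class gamma V ->
  is_grushin_operator V P ->
  - pi <= a -> a < b -> b <= pi ->
  (forall E : R, op_eigenvalue P E -> has_dimension (op_eigenspace P E) 2) ->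
  exists C : R, 0 < C /\
    forall (E : R) (phi : R * R -> R[i]), 0 <= E -> op_eigenspace P E phi ->
      L2norm cylinder phi <= C * L2norm (strip `]a, b[) phi.
Proof.
move=> _ _ gP api ab bpi dim2.
pose K := 2 * pi / (b - a - `|sin (b - a)|).
have K0 : 0 < K.
  rewrite divr_gt0 ?mulr_gt0 ?pi_gt0//.
  by rewrite subr_gt0 norm_sin_lt// subr_gt0.
exists (Num.sqrt K); split=> [|E phi _ Sphi]; first by rewrite sqrtr_gt0.
have [LX _] : L20X phi by case: (operator_L20X gP Sphi).
have [_ mr mi fin] := LX.
rewrite /L2norm -sqrtrM ?(ltW K0)// ler_wsqrtr//.
pose I : set (measurableTypeR R) := `]a, b[%classic.
have mI : measurable I by exact: measurable_itv.
have Icirc : I `<=` `[- pi, pi]%classic.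
  by move=> y; rewrite /I /= !in_itv/= => /andP[ay yb]; apply/andP; split; lra.
have ms : measurable_fun [set: (measurableTypeR R * measurableTypeR R)%type] (fun z =>
  sqmod (phi z)).
  by apply: measurable_funD; exact: measurable_funX.
have s0 z : 0 <= sqmod (phi z) by rewrite addr_ge0 ?sqr_ge0.
have key : (\int[area]_(z in cylinder) (sqmod (phi z))%:E <=
    K%:E * \int[area]_(z in strip I) (sqmod (phi z))%:E)%E.
  (* When phi is zero, E need not be an eigenvalue. *)
  have [phi0|phi0] := pselect (eqX phi (fun=> 0)).
    rewrite (@ae_cylinder_integral R _ _ (fun=> 0) (@measurable_circle R))//.
      rewrite integral0 mule_ge0 ?lee_fin ?(ltW K0)// integral_ge0// => z _.
      by rewrite lee_fin.
    apply: (@filterS _ _ (@area_ae_filter R) _ _ _ phi0) => z hz /hz ->.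
    by rewrite /sqmod /= expr0n addr0.
  have [n [c1 [d1 [c2 [d2 [n0 [mc1 md1] [mc2 md2] phiE]]]]]] :=
    eigenspace_single_frequency gP (dim2 E (ex_intro2 _ _ phi Sphi phi0)) Sphi phi0.
  have m1 := measurable_wave n mc1 md1; have m2 := measurable_wave n mc2 md2.
  rewrite (sqmod_strip_split (@measurable_circle R) _ LX m1 m2 phiE)//.
  rewrite (sqmod_strip_split mI Icirc LX m1 m2 phiE).
  rewrite ge0_muleDr; [|by apply: integral_ge0 => z _; rewrite lee_fin sqr_ge0..].
  by apply: leeD; exact: wave_concentration.
(* L2norm is real-valued, with junk value on infinite integrals. *)
have fin2 : (\int[area]_(z in strip I) (sqmod (phi z))%:E < +oo)%E.
  apply: le_lt_trans fin; apply: ge0_subset_integral => //.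
  - exact: measurable_strip.
  - exact: measurable_cylinder.
  - by apply/measurable_EFinP; exact: measurable_funTS.
  - by move=> z _; rewrite lee_fin.
  - by move=> z; exact: Icirc.
have ge01 : (0 <= \int[area]_(z in cylinder) (sqmod (phi z))%:E)%E.
  by apply: integral_ge0 => z _; rewrite lee_fin.
have ge02 : (0 <= \int[area]_(z in strip I) (sqmod (phi z))%:E)%E.
  by apply: integral_ge0 => z _; rewrite lee_fin.
rewrite /Rintegral -lee_fin EFinM !fineK ?ge0_fin_numE//.
Qed.
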